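(* Let $G$ be a circle graph with clique number at most $3$, and let $\mathcal{I}$ be an interval system with overlap graph $G$. Let $(P,\preceq, \psi)$ be a pillar assignment of $\mathcal{I}$ such that $\chi(P,\preceq, \psi) \le 19$, and $d_{(P,\preceq, \psi)}(K)\le 13$ for every arch $K$ of $(P,\preceq, \psi)$. Then there is a complete pillar assignment $(P^*,\preceq^*, \psi^* )$ of $\mathcal{I}$ extending $(P,\preceq, \psi)$ with $\chi(P^*,\preceq^*, \psi^* ) \le 19$.
   Context: An interval system is a finite collection $\mathcal I$ of open intervals contained in $(0,1)$ such that no two share an endpoint. For an interval $I$, $\ell(I)$, $r(I)$ are its left and right endpoints. Two distinct intervals overlap if they intersect and neither contains the other. The overlap graph of $\mathcal I$ has vertex set $\mathcal I$, with two intervals adjacent when they overlap; circle graphs are exactly such overlap graphs. For a set $\mathcal X$ of intervals, $\omega(\mathcal X)$ is the maximum size of a subset of pairwise overlapping intervals ($0$ if empty). A proper partial colouring of $\mathcal I$ is a map from a subset of $\mathcal I$ to the positive integers giving no two overlapping intervals the same colour. Structured colourings: if $\mathcal X\subseteq\mathcal I$ is a set of intervals all containing a common point and $C$ is a set of positive integers with $|C|=\omega(\mathcal X)$, a proper colouring $\phi:\mathcal X\to C$ is structured if (i) whenever $I_1,\dots,I_k\in\mathcal X$ satisfy $\phi(I_1)<\dots<\phi(I_k)$ and $\ell(I_1)<\dots<\ell(I_k)$, there are $k$ pairwise overlapping $I_1^*,\dots,I_k^*\in\mathcal X$ with all $\ell(I_j^* )\in[\ell(I_1),\ell(I_k)]$,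 and (ii) the same holds with $r$ in place of $\ell$ throughout. A pillar of $\mathcal I$ is a point of $(0,1)$ that is not an endpoint of any interval of $\mathcal I$. Let $P$ be a finite set of pillars totally ordered by $\preceq$. An interval $I\in\mathcal I$ is assigned to $p\in P$ if $p\in I$ and $I$ contains no $p'\in P$ with $p'\prec p$; $\mathcal I_p$ is the set of intervals assigned to $p$. The foundation $F_p$ is the open interval containing $p$, with endpoints in $\{p'\in P:p'\prec p\}\cup\{0,1\}$, containing no pillar $p'\prec p$; $\mathcal F_p$ is the set of intervals of $\mathcal I$ with exactly one endpoint in $F_p$. A pillar assignment is a triple $(P,\preceq,\psi)$ with $\psi=\bigcup_{p\in P}\phi_p$, where in $\preceq$-order, with $\psi_{\prec p}=\bigcup_{p'\prec p}\phi_{p'}$, $C_p$ is the set of the $\omega(\mathcal I_p)$ smallest positive integers not in $\psi_{\prec p}(\mathcal F_p)$ and $\phi_p:\mathcal I_p\to C_p$ is a structured colouring. It is complete if every interval of $\mathcal I$ contains a pillar of $P$. $\chi(P,\preceq,\psi)=|\psi(\mathcal I)|$ is the number of colours used. An arch of $(P,\preceq,\psi)$ is an open interval whose endpoints lie in $\{0,1\}\cup P$ and which contains no pillar of $P$. For an open interval $J$ contained in an arch, the degree $d_{(P,\preceq,\psi)}(J)$ is the number of distinct colours $\psi(I)$ taken over the intervals $I\in\mathcal I$ coloured by $\psi$ that have an endpoint in $J$. A pillar assignment $(P^*,\preceq^*,\psi^* )$ extends $(P,\preceq,\psi)$ if $P\subseteq P^*$, every pillar of $P$ precedes every pillar of $P^*\setminus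 P$ in $\preceq^*$, the restriction of $\preceq^*$ to $P$ is $\preceq$, and $\psi^*$ extends $\psi$. *)

(* Defs.v *)
(* Written with MathComp, finmap and the classical/reals layers of
   MathComp-Analysis. *)
From HB Require Import structures.
From mathcomp Require Export all_boot all_order all_algebra.
From mathcomp Require Export finmap.
From mathcomp Require Export boolp reals.

Set Implicit Arguments.
Unset Strict Implicit.
Unset Printing Implicit Defensive.

Import Order.TTheory GRing.Theory Num.Theory.

Local Open Scope ring_scope.
Local Open Scope fset_scope.
Local Open Scope fmap_scope.

Definition simple_graph (T : finType) (e : rel T) : Prop :=
  symmetric e /\ irreflexive e.

Definition clique_number (T : finType) (e : rel T) : nat :=
  \max_(Q : {set T} | [forall x in Q, forall y in Q, (x != y) ==> e x y]) #|Q|.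

(* Open intervals are encoded by the pair of their endpoints. *)
Definition oitv (R : realType) (I : R * R) : interval R := `]I.1, I.2[.

(* The bounds 0 <= I.1 and I.2 <= 1 say that the nonempty open interval I is
   contained in ]0, 1[. *)
Definition interval_system (R : realType) (S : {fset R * R}) : Prop :=
  (forall I, I \in S -> [/\ 0 <= I.1, I.1 < I.2 & I.2 <= 1]) /\
  (forall I J, I \in S -> J \in S -> I != J ->
     [/\ I.1 != J.1, I.1 != J.2, I.2 != J.1 & I.2 != J.2]).

Definition overlap (R : realType) (I J : R * R) : Prop :=
  [/\ I != J,
      (exists x, x \in oitv I /\ x \in oitv J),
      ~ {subset oitv I <= oitv J}
    & ~ {subset oitv J <= oitv I}].

(* The vertex type is the finite type of elements of S. *)
Definition overlap_graph (R : realType) (S : {fset R * R}) : rel S :=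
  fun I J => `[< overlap (val I) (val J) >].

Definition has_overlap_graph (R : realType) (T : finType) (S : {fset R * R})
    (e : rel T) : Prop :=
  exists2 f : T -> S, bijective f
    & forall x y, e x y = overlap_graph (f x) (f y).

Definition circle_graph (R : realType) (T : finType) (e : rel T) : Prop :=
  exists2 S : {fset R * R}, interval_system S & has_overlap_graph S e.

Definition omega (R : realType) (X : {fset R * R}) : nat :=
  clique_number (@overlap_graph R X).

Definition partial_colouring (R : realType) : Type := {fmap R * R -> nat}.

(* Condition (i), resp. (ii), of a structured colouring is the instance
   endpt := fst, resp. endpt := snd. The number of intervals is k.+1. *)
Definition structured_wrt (R : realType) (endpt : R * R -> R)
    (X : {fset R * R}) (phi : partial_colouring R) : Prop :=
  forall (k : nat) (I : 'I_k.+1 -> R * R) (c : 'I_k.+1 -> nat),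
    (forall j, I j \in X) ->
    (forall j, phi.[? I j] = Some (c j)) ->
    (forall i j : 'I_k.+1, (i < j)%N -> (c i < c j)%N) ->
    (forall i j : 'I_k.+1, (i < j)%N -> endpt (I i) < endpt (I j)) ->
    exists I' : 'I_k.+1 -> R * R,
      [/\ forall j, I' j \in X,
          forall i j, i != j -> overlap (I' i) (I' j)
        & forall j, endpt (I ord0) <= endpt (I' j) <= endpt (I ord_max)].

Definition structured_colouring (R : realType) (X : {fset R * R})
    (C : {fset nat}) (phi : partial_colouring R) : Prop :=
  [/\ (exists x, forall I, I \in X -> x \in oitv I),
      (forall c, c \in C -> (0 < c)%N) /\ #|` C| = omega X,
      domf phi = X /\ codomf phi `<=` C,
      forall I J c, overlap I J -> phi.[? I] = Some c -> phi.[? J] <> Some c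
    & structured_wrt fst X phi /\ structured_wrt snd X phi].

(* C is the set of the k smallest positive integers not in A. *)
Definition smallest_colours (A : {fset nat}) (k : nat) (C : {fset nat}) : Prop :=
  [/\ #|` C| = k,
      forall c, c \in C -> (0 < c)%N /\ c \notin A
    & forall c d, c \in C -> (0 < d < c)%N -> d \notin A -> d \in C].

(* A triple (P, <=, psi); only the values of pa_le on P are relevant. *)
Record assignment (R : realType) := Assignment {
  pa_pillars : {fset R};
  pa_le : rel R;
  pa_col : partial_colouring R }.

Section Assignments.
Variables (R : realType) (S : {fset R * R}) (A : assignment R).
Let P := pa_pillars A.
Let psi := pa_col A.

Definition pillar (p : R) : Prop :=
  0 < p < 1 /\ forall I, I \in S -> p != I.1 /\ p != I.2.

Definition pa_lt (p q : R) : bool := (p != q) && pa_le A p q.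

Definition assigned (p : R) : {fset R * R} :=
  [fset I in S | `[< p \in oitv I /\
     forall q, q \in P -> pa_lt q p -> q \notin oitv I >] ].

Definition foundation (p : R) (F : R * R) : Prop :=
  let bounds := 0 |` (1 |` [fset q in P | pa_lt q p]) in
  [/\ F.1 \in bounds, F.2 \in bounds, p \in oitv F
    & forall q, q \in P -> pa_lt q p -> q \notin oitv F].

Definition crossing (F : R * R) : {fset R * R} :=
  [fset I in S | (I.1 \in oitv F) (+) (I.2 \in oitv F)].

(* The colouring phi_p, recovered from psi as its restriction to the
   intervals assigned to p. *)
Definition pa_phi (p : R) : partial_colouring R := psi.[& assigned p].

(* The colouring psi_{< p}. *)
Definition pa_before (p : R) : partial_colouring R :=
  psi.[& \bigcup_(q <- P | pa_lt q p) assigned q].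

Definition pillar_assignment : Prop :=
  [/\ forall p, p \in P -> pillar p,
      [/\ {in P, reflexive (pa_le A)}, {in P &, antisymmetric (pa_le A)},
          {in P & &, transitive (pa_le A)} & {in P &, total (pa_le A)}],
      domf psi = \bigcup_(p <- P) assigned p
    & forall p, p \in P -> exists (F : R * R) (C : {fset nat}),
        [/\ foundation p F,
            smallest_colours (codomf (pa_before p).[& crossing F])
              (omega (assigned p)) C
          & structured_colouring (assigned p) C (pa_phi p)]].

Definition complete : Prop :=
  forall I, I \in S -> exists2 p, p \in P & p \in oitv I.

Definition chi : nat := #|` codomf psi|.

Definition arch (K : R * R) : Prop :=
  [/\ K.1 < K.2, K.1 \in 0 |` (1 |` P), K.2 \in 0 |` (1 |` P)
    & forall p, p \in P -> p \notin oitv K].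

Definition degree (J : R * R) : nat :=
  #|` codomf psi.[& [fset I in S |
        (I.1 \in oitv J) || (I.2 \in oitv J)]] |.

End Assignments.

(* B extends A. *)
Definition extends (R : realType) (A B : assignment R) : Prop :=
  [/\ pa_pillars A `<=` pa_pillars B,
      forall p q, p \in pa_pillars A -> q \in pa_pillars B `\` pa_pillars A ->
        pa_lt B p q,
      {in pa_pillars A &, forall p q, pa_le B p q = pa_le A p q}
    & forall I c, (pa_col A).[? I] = Some c -> (pa_col B).[? I] = Some c].

(* Main.v *)
(** Every uncovered interval lies in an arch [K].  If [K] has degree at most 10,
a pillar inside that interval adds at most three colours, and the new arches
have degree at most 13.  Otherwise seven cuts, each placed just before an
endpoint of a coloured interval, divide [K] into segments carrying at most
seven of the old colours: if this failed, there would be eight consecutive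
segments with at least eight colours each, and four endpoints in increasing
order of position and of key (pillar, colour).  As the given colourings are
structured, these yield four pairwise overlapping intervals.  A pillar just
before an endpoint of a coloured interval adds at most two colours, since the
coloured interval extends every clique of new intervals.  Inserting the seven
cuts in the order of a binary tree, of depth three, gives final degrees at most
7 + 2 * 3 = 13 and colours at most 13 + 2 * 2 + 2 = 19.

Structured colourings are obtained by colouring an interval by its height in
the order in which [J] precedes [I] when both endpoints do. *)
Require Import Defs.
From mathcomp Require Import zify lra.

Set Implicit Arguments.
Unset Strict Implicit.
Unset Printing Implicit Defensive.

Import Order.TTheory GRing.Theory Num.Theory.

Local Open Scope ring_scope.
Local Open Scope fset_scope.
Local Open Scope fmap_scope.

(** * Cliques in finite graphs *)

Section Cliques.
Variables (T : finType) (e : rel T).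
Hypothesis symm_e : symmetric e.

Lemma clique_number_ge (s : seq T) :
  uniq s -> pairwise e s -> (size s <= clique_number e)%N.
Proof.
move=> us /(pairwiseP _) ps.
rewrite -(card_uniqP us) -[#|s|]cardsE.
apply: (@leq_bigmax_cond _ _ (fun Q : {set T} => #|Q|)).
apply/forall_inP => x; rewrite inE => xs; apply/forall_inP => y; rewrite inE => ys.
apply/implyP => nxy.
rewrite -(nth_index x xs) -(nth_index x ys).
have : index x s != index y s.
  by apply: contra nxy => /eqP E; rewrite -(nth_index x xs) E nth_index.
by rewrite neq_ltn => /orP[] l; last rewrite symm_e; apply: ps;
  rewrite ?inE ?index_mem.
Qed.

Lemma clique_number_witness :
  exists s : seq T, [/\ uniq s, pairwise e s & size s = clique_number e].
Proof.
pose F (Q : {set T}) := [forall x in Q, forall y in Q, (x != y) ==> e x y].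
have F0 : F set0 by apply/forall_inP => x; rewrite inE.
have [Q FQ EQ] : {Q | Q \in F & clique_number e = #|Q|}.
  by apply: eq_bigmax_cond; apply/card_gt0P; exists set0.
exists (enum Q); split; [exact: enum_uniq | | by rewrite EQ cardE].
have := enum_uniq Q; rewrite uniq_pairwise.
apply: (@sub_in_pairwise _ (mem Q)); last by apply/allP => x; rewrite mem_enum.
move=> x y xQ yQ /= nxy; move/forall_inP: FQ => /(_ x xQ)/forall_inP/(_ y yQ).
by rewrite nxy.
Qed.

End Cliques.

(** * Overlapping intervals and their cliques *)

Definition overlaps (R : realType) (I J : R * R) : bool := `[< overlap I J >].

Definition crosses (R : realType) (I J : R * R) : bool :=
  [&& I.1 < J.1, J.1 < I.2 & I.2 < J.2].

Section Omega.
Variable R : realType.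
Implicit Types (I J : R * R) (X : {fset R * R}) (s : seq (R * R)).

Lemma overlaps_sym : symmetric (@overlaps R).
Proof.
suff H I J : overlaps I J -> overlaps J I by move=> I J; apply/idP/idP; exact: H.
move=> /asboolP[nIJ [x [xI xJ]] nI nJ]; apply/asboolP; split=> //.
  by rewrite eq_sym.
by exists x.
Qed.

Lemma overlaps_irr : irreflexive (@overlaps R).
Proof. by move=> I; apply/asboolP => -[]; rewrite eqxx. Qed.

Lemma crosses_overlaps I J : crosses I J -> overlaps I J.
Proof.
move=> /and3P[l1 l2 l3]; apply/asboolP; split.
- by apply/eqP => E; rewrite E ltxx in l1.
- by exists ((J.1 + I.2) / 2); rewrite !in_itv /=; split; lra.
- move=> /(_ ((I.1 + J.1) / 2)); rewrite !in_itv /=.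
  have -> : I.1 < (I.1 + J.1) / 2 < I.2 by lra.
  by move=> /(_ isT); lra.
- move=> /(_ ((I.2 + J.2) / 2)); rewrite !in_itv /=.
  have -> : J.1 < (I.2 + J.2) / 2 < J.2 by lra.
  by move=> /(_ isT); lra.
Qed.

(** Distinct endpoints order the left ends strictly, failed containment then orders the right ends,
    and the common point gives the middle inequality. *)
Lemma overlaps_crosses (S : {fset R * R}) I J :
  interval_system S -> I \in S -> J \in S ->
  overlaps I J = crosses I J || crosses J I.
Proof.
move=> [_ HS] IS JS; apply/idP/idP; last first.
  by case/orP => /crosses_overlaps //; rewrite overlaps_sym.
move=> /asboolP[nIJ [x []]]; rewrite !in_itv /= => xI xJ nI nJ.
have [n11 n12 n21 n22] := HS I J IS JS nIJ.
have [l1|l1|E] := ltgtP I.1 J.1; last by rewrite E eqxx in n11.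
  rewrite /crosses l1 /= (ltNge J.1 I.1) (ltW l1) /= orbF; apply/andP; split; first by lra.
  rewrite ltNge; apply/negP => l2; apply: nJ => y; rewrite !in_itv /=; lra.
rewrite /crosses l1 /= (ltNge I.1 J.1) (ltW l1) /=; apply/andP; split; first by lra.
rewrite ltNge; apply/negP => l2; apply: nI => y; rewrite !in_itv /=; lra.
Qed.

Lemma pairwise_overlaps_uniq s : pairwise (@overlaps R) s -> uniq s.
Proof.
rewrite uniq_pairwise; apply: sub_pairwise => I J.
by apply: contraTneq => ->; rewrite overlaps_irr.
Qed.

Lemma overlap_graph_sym X : symmetric (@overlap_graph R X).
Proof. by move=> I J; exact: overlaps_sym. Qed.

(** Lets cliques be handled as sequences of intervals instead of sets in the vertex type of the
    overlap graph. Irreflexivity of overlap makes such sequences duplicate-free. *)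
Lemma omega_ge X s :
  {subset s <= X} -> pairwise (@overlaps R) s -> (size s <= omega X)%N.
Proof.
move=> sX ps.
have Es : map val (pmap (insub : _ -> option X) s) = s.
  rewrite (pmap_filter (insubK _)); apply/all_filterP/allP => I Is.
  by rewrite insubT // sX.
rewrite -Es size_map; apply: clique_number_ge; first exact: overlap_graph_sym.
  by rewrite -(map_inj_uniq val_inj) Es pairwise_overlaps_uniq.
by move: ps; rewrite -{1}Es pairwise_map.
Qed.

Lemma omega_witness X :
  exists s, [/\ {subset s <= X}, pairwise (@overlaps R) s & size s = omega X].
Proof.
have [s [_ ps ss]] := clique_number_witness (@overlap_graph R X).
exists (map val s); split; last by rewrite size_map.
  by move=> _ /mapP[I _ ->]; exact: valP.
by rewrite pairwise_map.
Qed.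

Lemma omega_sub X Y : X `<=` Y -> (omega X <= omega Y)%N.
Proof.
move=> /fsubsetP XY; have [s [sX ps <-]] := omega_witness X.
by apply: omega_ge => // I /sX /XY.
Qed.

Lemma omega_clique_number (T : finType) (e : rel T) (S : {fset R * R}) :
  has_overlap_graph S e -> (omega S <= clique_number e)%N.
Proof.
move=> [f [g fK gK] Ef].
have se : symmetric e by move=> x y; rewrite !Ef overlap_graph_sym.
rewrite /omega; have [s [us ps <-]] := clique_number_witness (@overlap_graph R S).
rewrite -(size_map g); apply: clique_number_ge => //.
  by rewrite map_inj_uniq //; exact: can_inj gK.
by rewrite pairwise_map; apply: sub_pairwise ps => I J; rewrite /= Ef !gK.
Qed.

End Omega.

(** * Finite sequences and smallest available colours *)

Lemma pairwise_in (T : eqType) (r : rel T) (s : seq T) x y :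
  symmetric r -> pairwise r s -> x \in s -> y \in s -> x != y -> r x y.
Proof.
move=> sr; elim: s => //= z s IH /andP[/allP az ps].
rewrite !inE => /predU1P[->|xs] /predU1P[->|ys]; rewrite ?eqxx //.
- by move=> _; exact: az.
- by move=> _; rewrite sr; exact: az.
- exact: IH.
Qed.

Lemma seq_max (R : realType) (T : eqType) (f : T -> R) (s : seq T) x :
  x \in s -> exists2 m, m \in s & forall y, y \in s -> f y <= f m.
Proof.
elim: s x => //= z [|z' s] IH x.
  by move=> _; exists z; rewrite ?mem_head // => y; rewrite inE => /eqP->.
move=> _; have [m ms Hm] := IH z' (mem_head _ _).
have [l|l] := leP (f z) (f m).
  exists m; first by rewrite inE ms orbT.
  by move=> y; rewrite inE => /predU1P[->//|]; exact: Hm.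
exists z; first exact: mem_head.
move=> y; rewrite inE => /predU1P[->//|ys]; exact: le_trans (Hm _ ys) (ltW l).
Qed.

Lemma seq_min (R : realType) (T : eqType) (f : T -> R) (s : seq T) x :
  x \in s -> exists2 m, m \in s & forall y, y \in s -> f m <= f y.
Proof.
move=> /(seq_max (fun y => - f y))[m ms Hm]; exists m => // y /Hm.
by rewrite lerN2.
Qed.

(** In an initial stretch whose length is [k] plus the size of [A], at least [k] integers lie
    outside [A]. They are listed in increasing order so that heights can index them; the final bound
    later limits the palette. *)
Lemma smallest_colours_exists (A : {fset nat}) k : exists cs : seq nat,
  [/\ size cs = k, sorted ltn cs, smallest_colours A k [fset c in cs]
    & forall c, c \in cs -> (c <= #|` A| + k)%N].
Proof.
pose n := (#|` A| + k)%N.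
pose fl := [seq c <- iota 1 n | c \notin A].
have sfl : (k <= size fl)%N.
  have -> : size fl = (n - count (mem A) (iota 1 n))%N.
    by rewrite size_filter -[X in (X - _)%N](size_iota 1 n) -(count_predC (mem A)) addKn.
  suff : (count (mem A) (iota 1 n) <= #|` A|)%N by rewrite /n; lia.
  rewrite -size_filter; apply: uniq_leq_size; first by rewrite filter_uniq ?iota_uniq.
  by move=> c; rewrite mem_filter => /andP[].
have sst : sorted ltn (take k fl).
  by apply/take_sorted/(sorted_filter ltn_trans)/iota_ltn_sorted.
have ut : uniq (take k fl) by rewrite take_uniq // filter_uniq ?iota_uniq.
exists (take k fl); split=> //.
- by rewrite size_takel.
- split.
  + by rewrite card_fseq undup_id // size_takel.
  + by move=> c; rewrite inE => /mem_take; rewrite mem_filter mem_iota => /andP[-> /andP[]].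
  + move=> c d; rewrite !inE => ct /andP[d0 dc] dA.
    have cfl := mem_take ct.
    have dfl : d \in fl.
      move: cfl; rewrite !mem_filter !mem_iota dA d0 /= => /and3P[_ _]; exact: ltn_trans.
    move: ct; rewrite !in_take //; apply: leq_trans; rewrite ltnS leqNgt; apply/negP => l.
    suff : (c <= d)%N by rewrite leqNgt dc.
    apply: (sorted_leq_index leq_trans leqnn _ c d cfl dfl (ltnW l)).
    exact/(sorted_filter leq_trans)/iota_sorted.
- move=> c /mem_take; rewrite mem_filter mem_iota => /and3P[_ _].
  by rewrite add1n ltnS.
Qed.

(* Among intervals sharing a point, overlapping means being comparable for the
   product order on endpoints; cliques are chains. *)
Definition below (R : realType) (I J : R * R) : bool :=
  (I.1 < J.1) && (I.2 < J.2).

(** When the intervals of [X] share a point, this is the length of a longest chain strictly below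
    [I], the usual height in a poset. *)
Definition height (R : realType) (X : {fset R * R}) (I : R * R) : nat :=
  omega [fset J in X | below J I].

Lemma below_trans (R : realType) : transitive (@below R).
Proof.
by move=> J I K /andP[a b] /andP[c d]; rewrite /below (lt_trans a) ?(lt_trans b).
Qed.

(** * Structured colourings by height *)

Section Height.
Variables (R : realType) (S X : {fset R * R}) (x0 : R).
Hypothesis HS : interval_system S.
Hypothesis XS : {subset X <= S}.
Hypothesis Xx : forall I, I \in X -> x0 \in oitv I.
Implicit Types (I J : R * R).

Lemma overlaps_below I J : I \in X -> J \in X ->
  overlaps I J = below I J || below J I.
Proof.
move=> IX JX; rewrite (overlaps_crosses HS) ?XS // /crosses /below.
have := Xx IX; have := Xx JX; rewrite !in_itv /= => /andP[a b] /andP[c d].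
by rewrite (lt_trans a d) (lt_trans c b).
Qed.

(** Appending [I] to a longest chain below it gives a chain below [J]. Hence overlapping intervals
    differ in height. *)
Lemma height_lt I J : I \in X -> below I J -> (height X I < height X J)%N.
Proof.
move=> IX IJ; rewrite [height X I]/height; have [s [sX ps <-]] := omega_witness [fset J in X | below J I].
have sI K : K \in s -> K \in X /\ below K I by move=> /sX; rewrite !inE => /andP[].
rewrite -(size_rcons s I); apply: omega_ge.
  move=> K; rewrite mem_rcons !inE => /predU1P[->|/sI[-> KI]]; first by rewrite IX.
  exact: below_trans IJ.
rewrite pairwise_rcons ps andbT; apply/allP => K /sI[KX KI].
by rewrite overlaps_below ?KI.
Qed.

Lemma height_omega I : I \in X -> (height X I < omega X)%N.
Proof.
move=> IX; rewrite [height X I]/height; have [s [sX ps <-]] := omega_witness [fset J in X | below J I].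
have sI K : K \in s -> K \in X /\ below K I by move=> /sX; rewrite !inE => /andP[].
rewrite -(size_rcons s I); apply: omega_ge.
  by move=> K; rewrite mem_rcons !inE => /predU1P[->//|/sI[->]].
rewrite pairwise_rcons ps andbT; apply/allP => K /sI[KX KI].
by rewrite overlaps_below ?KI.
Qed.

(** In a longest chain below [I], the interval with the largest left endpoint has all the others
    below it. *)
Lemma height_pred I : (0 < height X I)%N ->
  exists J, [/\ J \in X, below J I & (height X I <= (height X J).+1)%N].
Proof.
have [s [sX ps]] := omega_witness [fset J in X | below J I].
rewrite -/(height X I) => <- s0.
have sI K : K \in s -> K \in X /\ below K I by move=> /sX; rewrite !inE => /andP[].
have [J Js HJ] : exists2 J, J \in s & forall K, K \in s -> K.1 <= J.1.
  by case: (s) s0 => // K s' _; exact: seq_max (mem_head _ _).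
have [JX JI] := sI J Js.
exists J; split=> //.
rewrite (perm_size (perm_to_rem Js)) ltnS; apply: omega_ge; last first.
  exact: subseq_pairwise (rem_subseq _ _) ps.
move=> K; rewrite (mem_rem_uniq _ (pairwise_overlaps_uniq ps)) !inE => /andP[nKJ Ks].
have [KX KI] := sI K Ks; rewrite KX /=.
have := pairwise_in (@overlaps_sym R) ps Ks Js nKJ.
rewrite overlaps_below // => /orP[//|/andP[]].
by rewrite ltNge HJ.
Qed.

(** If [f k] is not below [f k.+1], its [b]-value is at least that of [f k.+1]; a predecessor [J] of
    [f k.+1] with a smaller [a]-value than [f k] would then lie below [f k] and be too low. So [J]
    can replace [f k], and the induction goes on downwards. The coordinates are abstract to serve
    both left and right endpoints. *)
Lemma height_chain (a b : R * R -> R) :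
  (forall I J, below I J = (a I < a J) && (b I < b J)) ->
  forall k (f : nat -> R * R),
  (forall i, (i <= k)%N -> f i \in X) ->
  (forall i j, (i < j <= k)%N -> (height X (f i) < height X (f j))%N) ->
  (forall i j, (i < j <= k)%N -> a (f i) < a (f j)) ->
  exists g : nat -> R * R,
    [/\ forall i, (i <= k)%N -> g i \in X,
        forall i j, (i < j <= k)%N -> below (g i) (g j),
        a (f 0%N) <= a (g 0%N) & g k = f k].
Proof.
move=> ab; elim=> [|k IH] f fX fh fa.
  by exists f; split=> // i j; rewrite leqn0 => /andP[] /[swap] /eqP->.
have hk := fh k k.+1; have ak := fa k k.+1; rewrite ltnSn in hk ak.
(* The last but one interval may be replaced by a predecessor of the last one. *)
have [J [JX JI Jh Ja]] : exists J, [/\ J \in X, below J (f k.+1),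
    (height X (f k) <= height X J)%N & a (f k) <= a J].
  have [l|nl] := boolP (below (f k) (f k.+1)); first by exists (f k); rewrite fX.
  have [J [JX JI hJ]] := height_pred (leq_ltn_trans (leq0n _) (hk isT)).
  exists J; split=> //; first by rewrite -ltnS (leq_trans (hk isT)).
  rewrite leNgt; apply/negP => aJ.
  suff : below J (f k) by move/(height_lt JX); have := hk isT; lia.
  rewrite ab aJ /=; move: JI nl; rewrite !ab (ak isT) /= => /andP[_ bJ].
  by rewrite -leNgt; exact: lt_le_trans.
have [] := IH (fun i => if i == k then J else f i).
- by move=> i ik /=; case: eqP => // _; apply/fX/ltnW.
- move=> i j /andP[ij jk] /=; rewrite (ltn_eqF (leq_trans ij jk)).
  case: eqP => [E|_]; last by apply: fh; lia.
  by subst j; apply: leq_trans Jh; apply: fh; lia.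
- move=> i j /andP[ij jk] /=; rewrite (ltn_eqF (leq_trans ij jk)).
  case: eqP => [E|_]; last by apply: fa; lia.
  by subst j; apply: lt_le_trans Ja; apply: fa; lia.
rewrite /= eqxx => g [gX gb g0 gk].
exists (fun i => if i == k.+1 then f k.+1 else g i); split.
- move=> i ik; case: eqP => [_|/eqP n]; first exact: fX.
  by apply: gX; rewrite -ltnS ltn_neqAle n.
- move=> i j /andP[ij jk]; rewrite (ltn_eqF (leq_trans ij jk)).
  case: eqP => [E|/eqP n]; last by apply: gb; rewrite ij -ltnS ltn_neqAle n.
  have := ij; rewrite E ltnS leq_eqVlt => /predU1P[->|ik]; first by rewrite gk.
  by apply: below_trans (gb i k _) _; rewrite ?ik ?leqnn ?gk.
- apply: le_trans g0; case: eqP => // k0.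
  by subst k.
- by rewrite eqxx.
Qed.

Definition height_colouring (cs : seq nat) : partial_colouring R :=
  [fmap I : X => nth 0%N cs (height X (val I))].

Lemma height_colouringE cs I : (height_colouring cs).[? I] =
  if I \in X then Some (nth 0%N cs (height X I)) else None.
Proof.
have [IX|nIX] := boolP (I \in X); last by apply: not_fnd.
have IX' : I \in domf (height_colouring cs) by [].
by rewrite (in_fnd IX') ffunE.
Qed.

(** As [cs] increases, increasing colours mean increasing heights, and [height_chain] supplies the
    clique. Its [a]-values start no earlier than the first interval and stop at the last. *)
Lemma height_colouring_structured_wrt cs (a b : R * R -> R) :
  (forall I J, below I J = (a I < a J) && (b I < b J)) ->
  sorted ltn cs -> size cs = omega X ->
  structured_wrt a X (height_colouring cs).
Proof.
move=> ab scs zcs k I c IX Ic cm am.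
have Ec j : c j = nth 0%N cs (height X (I j)).
  by have := Ic j; rewrite height_colouringE IX => -[].
have [] := height_chain ab (k := k) (f := fun i => I (inord i)).
- by move=> i _; exact: IX.
- move=> i j /andP[ij jk].
  have := cm (inord i) (inord j).
  rewrite !inordK ?ltnS // ?(leq_trans (ltnW ij)) // ij !Ec => /(_ isT) l.
  rewrite ltnNge; apply/negP => h.
  move: l; apply/negP; rewrite -leqNgt.
  have hi := height_omega (IX (inord i)); have hj := height_omega (IX (inord j)).
  move: scs; rewrite ltn_sorted_uniq_leq => /andP[_ scs].
  by apply: (sorted_leq_nth leq_trans leqnn 0%N scs); rewrite ?inE ?zcs.
- move=> i j /andP[ij jk]; apply: am.
  by rewrite !inordK ?ltnS // ?(leq_trans (ltnW ij)).
move=> g [gX gb g0 gk].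
have ga i j : (i <= j <= k)%N -> a (g i) <= a (g j).
  case/andP; rewrite leq_eqVlt => /predU1P[->//|ij] jk.
  by have := gb i j; rewrite ij jk ab => /(_ isT)/andP[/ltW].
exists (fun j => g (val j)); split.
- by move=> j; apply: gX; rewrite -ltnS ltn_ord.
- move=> i j; rewrite -val_eqE neq_ltn => ij; apply/asboolP.
  rewrite -/(overlaps _ _) overlaps_below ?gX // -1?ltnS ?ltn_ord //.
  by case/orP: ij => ij; [rewrite (gb i j) // | rewrite (gb j i) ?orbT //];
    rewrite ij -ltnS ltn_ord.
- move=> j; have jk : (j <= k)%N by rewrite -ltnS ltn_ord.
  have -> : ord0 = inord 0 :> 'I_k.+1 by apply: val_inj; rewrite /= inordK.
  rewrite (le_trans g0) ?ga //=.
  have -> : ord_max = inord k :> 'I_k.+1 by apply: val_inj; rewrite /= inordK.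
  by rewrite -gk ga // jk leqnn.
Qed.

Lemma height_colouring_structured cs :
  (forall c, c \in cs -> (0 < c)%N) -> sorted ltn cs -> size cs = omega X ->
  structured_colouring X [fset c in cs] (height_colouring cs).
Proof.
move=> cs0 scs zcs.
have ucs : uniq cs by move: scs; rewrite ltn_sorted_uniq_leq => /andP[].
split.
- by exists x0.
- split; first by move=> c; rewrite inE; exact: cs0.
  by rewrite card_fseq undup_id.
- split=> //; apply/fsubsetP => c /codomfP[I].
  rewrite height_colouringE; case: ifP => // IX [<-].
  by rewrite inE mem_nth // zcs height_omega.
- move=> I J c /asboolP; rewrite -/(overlaps I J) !height_colouringE.
  case: ifP => // IX oIJ [<-]; case: ifP => // JX [] /eqP.
  rewrite nth_uniq ?zcs ?height_omega // => /eqP E.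
  by move: oIJ; rewrite overlaps_below // => /orP[]/height_lt; rewrite E ltnn => /(_ _)/negP; apply.
- split.
    by apply: (@height_colouring_structured_wrt _ _ snd).
  by apply: (@height_colouring_structured_wrt _ _ fst) => // I J; rewrite /below andbC.
Qed.

End Height.

(** * Restrictions of finite maps *)

Lemma in_codomf_restrict (K : choiceType) (V : choiceType) (f : {fmap K -> V})
    (D : {fset K}) v :
  reflect (exists2 x, x \in D & f.[? x] = Some v) (v \in codomf f.[& D]).
Proof.
apply: (iffP (codomfP _ _)) => -[x].
  by rewrite fnd_restrict; case: ifP => // xD; exists x.
by move=> xD fx; exists x; rewrite fnd_restrict xD.
Qed.

Lemma fnd_domf (K : choiceType) (V : Type) (f : {fmap K -> V}) k :
  k \in domf f -> exists v, f.[? k] = Some v.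
Proof. by move=> kf; exists f.[kf]; rewrite Some_fnd. Qed.

Lemma domf_fnd (K : choiceType) (V : Type) (f : {fmap K -> V}) k v :
  f.[? k] = Some v -> k \in domf f.
Proof. by case: fndP. Qed.

Lemma in_fset_sep (K : choiceType) (D : {fset K}) (P : pred K) x :
  (x \in [fset y in D | P y]) = (x \in D) && P x.
Proof. by rewrite !inE. Qed.

(** * Adding a last pillar inside an arch *)

Section InsertPillar.
Variables (R : realType) (S : {fset R * R}).
Hypothesis HS : interval_system S.
Implicit Types (A B : assignment R) (I J L : R * R).

(** These are the intervals assigned to [p] once [p] is placed after all pillars of [A]. *)
Definition uncovered A p : {fset R * R} :=
  [fset I in S | (p \in oitv I) &&
    [forall q : pa_pillars A, val q \notin oitv I]].

Lemma uncoveredP A p I : reflect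
  [/\ I \in S, p \in oitv I & forall q, q \in pa_pillars A -> q \notin oitv I]
  (I \in uncovered A p).
Proof.
rewrite !inE /=; apply: (iffP and3P) => -[IS pI H]; split=> //.
  by move=> q qP; move/forallP: H => /(_ [` qP]).
by apply/forallP => q; exact/H/valP.
Qed.

Lemma assignedP A p I : reflect
  [/\ I \in S, p \in oitv I
    & forall q, q \in pa_pillars A -> pa_lt A q p -> q \notin oitv I]
  (I \in assigned S A p).
Proof.
rewrite !inE /=; apply: (iffP andP) => [[IS /asboolP[]]|[IS pI H]] //.
by split=> //; apply/asboolP.
Qed.

Lemma colouredP A I : pillar_assignment S A -> reflect
  (exists2 p, p \in pa_pillars A & I \in assigned S A p) (I \in domf (pa_col A)).
Proof.
move=> [_ _ -> _]; apply: (iffP (bigfcupP _ _ _ _)) => -[p].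
  by rewrite andbT; exists p.
by move=> pP Ip; exists p; rewrite ?andbT.
Qed.

Lemma extends_refl A : extends A A.
Proof. by split=> // p q _; rewrite fsetDv inE. Qed.

Lemma extends_trans A B C : extends A B -> extends B C -> extends A C.
Proof.
move=> [PAB lAB eAB cAB] [PBC lBC eBC cBC]; split.
- exact: fsubset_trans PBC.
- move=> p q pA; rewrite inE => /andP[qA qC].
  have pB := fsubsetP PAB _ pA.
  have [qB|qB] := boolP (q \in pa_pillars B); last by apply: lBC => //; rewrite inE qB.
  have := lAB p q pA; rewrite inE qA qB /pa_lt eBC // => /(_ isT).
  by [].
- by move=> p q pA qA; rewrite eBC ?eAB // (fsubsetP PAB).
- by move=> I c /cAB /cBC.
Qed.

(** The ends of an arch are [0], [1] or pillars, and an uncovered interval contains no pillar of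
    [A]. *)
Lemma uncovered_in_arch A J p I : arch A J -> p \in oitv J ->
  I \in uncovered A p -> J.1 <= I.1 /\ I.2 <= J.2.
Proof.
move=> [_ J1 J2 _]; rewrite in_itv /= => /andP[Jp pJ] /uncoveredP[IS].
rewrite in_itv /= => /andP[Ip pI] nI; have [I0 I12 I1] := HS.1 _ IS.
split; rewrite leNgt; apply/negP => l.
  move: J1; rewrite !inE => /or3P[/eqP E|/eqP E|/nI]; try lra.
  by rewrite in_itv /= l (lt_trans Jp pI).
move: J2; rewrite !inE => /or3P[/eqP E|/eqP E|/nI]; try lra.
by rewrite in_itv /= l (lt_trans Ip pJ).
Qed.

(** The arch [J] is the foundation of the new pillar, so at most [degree S A J] colours are
    forbidden, and the height colouring uses the smallest others. As [p] comes last, nothing changes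
    for the old pillars. *)
Lemma insert_pillar A J p :
  pillar_assignment S A -> arch A J -> p \in oitv J -> pillar S p ->
  exists B, [/\ pillar_assignment S B, extends A B,
    pa_pillars B = p |` pa_pillars A,
    domf (pa_col B) = domf (pa_col A) `|` uncovered A p
  & (#|` codomf (pa_col B).[& uncovered A p]| <= omega (uncovered A p))%N /\
    forall I c, I \in uncovered A p -> (pa_col B).[? I] = Some c ->
      (0 < c <= degree S A J + omega (uncovered A p))%N].
Proof.
move=> VA aJ pJ Pp; have [VP [Vr Va Vt Vtot] Vd Vc] := VA.
have [J12 J1 J2 Jn] := aJ.
set X := uncovered A p.
(* The forbidden colours, with [J] as foundation and all of [pa_col A] as the earlier colouring. *)
pose forb := codomf (pa_col A).[& crossing S J].
have [cs [zcs scs sc csb]] := smallest_colours_exists forb (omega X).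
have cs0 c : c \in cs -> (0 < c)%N.
  by move=> cc; have [_ /(_ c)] := sc; rewrite inE => /(_ cc)[].
have XS : {subset X <= S} by move=> I /uncoveredP[].
have Xp I : I \in X -> p \in oitv I by move=> /uncoveredP[].
have hst := height_colouring_structured HS XS Xp cs0 scs zcs.
set hc := height_colouring X cs in hst.
have dhc : domf hc = X by [].
have pP : p \notin pa_pillars A by apply: contraTN pJ => /Jn.
have XnA I : I \in X -> I \notin domf (pa_col A).
  move=> /uncoveredP[_ _ nI]; apply/(colouredP _ VA) => -[q qP /assignedP[_ qI _]].
  by move: qI; apply/negP/nI.
(* The new pillar is placed after every old one. *)
pose le' : rel R := fun x y =>
  if y \in pa_pillars A then (x \in pa_pillars A) && pa_le A x y else true.
pose B := Assignment (p |` pa_pillars A) le' (pa_col A + hc).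
have ltAA q q' : q \in pa_pillars A -> q' \in pa_pillars A ->
    pa_lt B q q' = pa_lt A q q'.
  by move=> qP q'P; rewrite /pa_lt /= /le' q'P qP.
have ltpA q : q \in pa_pillars A -> pa_lt B p q = false.
  by move=> qP; rewrite /pa_lt /= /le' qP (negbTE pP) andbF.
have ltAp q : q \in pa_pillars A -> pa_lt B q p.
  move=> qP; rewrite /pa_lt /= /le' (negbTE pP) andbT.
  by apply: contraNneq pP => <-.
have ltpp : pa_lt B p p = false by rewrite /pa_lt eqxx.
have asA q : q \in pa_pillars A -> assigned S B q = assigned S A q.
  move=> qP; apply/fsetP => I; apply/assignedP/assignedP => -[IS qI H]; split=> //.
    by move=> r rP l; apply: H; rewrite ?inE ?rP ?orbT ?ltAA.
  move=> r; rewrite /= in_fset1U => /predU1P[->|rP]; first by rewrite ltpA.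
  by rewrite ltAA //; exact: H.
have asp : assigned S B p = X.
  apply/fsetP => I; apply/assignedP/uncoveredP => -[IS qI H]; split=> //.
    by move=> q qP; apply: H; rewrite ?ltAp // inE qP orbT.
  move=> q; rewrite /= in_fset1U => /predU1P[->|qP _]; first by rewrite ltpp.
  exact: H.
have colA I : I \notin X -> (pa_col B).[? I] = (pa_col A).[? I].
  by move=> IX; rewrite [LHS]fnd_cat [I \in domf hc](negbTE IX).
have colX I : I \in X -> (pa_col B).[? I] = hc.[? I].
  by move=> IX; rewrite [LHS]fnd_cat [I \in domf hc]IX.
have asnX q I : q \in pa_pillars A -> I \in assigned S A q -> I \notin X.
  move=> qP /assignedP[_ qI _]; apply/negP => /uncoveredP[_ _ /(_ q qP)].
  by rewrite qI.
have pbB q : q \in pa_pillars A -> pa_before S B q = pa_before S A q.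
  move=> qP; apply/fmapP => I; rewrite !fnd_restrict.
  have -> : (I \in \bigcup_(r <- pa_pillars B | pa_lt B r q) assigned S B r) =
            (I \in \bigcup_(r <- pa_pillars A | pa_lt A r q) assigned S A r).
    apply/bigfcupP/bigfcupP => -[r].
      rewrite in_fset1U => /andP[/predU1P[->|rP]]; first by rewrite ltpA.
      by rewrite ltAA // asA // => l Ir; exists r; rewrite ?rP.
    by move=> /andP[rP l] Ir; exists r; rewrite ?asA // inE rP orbT ltAA.
  case: ifP => // /bigfcupP[r /andP[rP _] Ir].
  exact/colA/(asnX r).
have pbp : pa_before S B p = pa_col A.
  apply/fmapP => I; rewrite fnd_restrict.
  have -> : (I \in \bigcup_(r <- pa_pillars B | pa_lt B r p) assigned S B r) =
            (I \in domf (pa_col A)).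
    apply/bigfcupP/(colouredP _ VA) => -[r].
      rewrite in_fset1U => /andP[/predU1P[->|rP]]; first by rewrite ltpp.
      by rewrite asA // => _; exists r.
    by move=> rP Ir; exists r; rewrite ?asA // inE rP orbT ltAp.
  case: ifP => [IA|/negbT IA]; last by rewrite not_fnd.
  by apply: colA; apply: contraTN IA => /XnA.
have dB : domf (pa_col B) = domf (pa_col A) `|` X by exact: domf_cat.
have hsub I c : I \in X -> (pa_col B).[? I] = Some c -> c \in cs.
  move=> IX; rewrite colX // => Ic.
  have [_ _ [_ /fsubsetP H] _ _] := hst.
  have /H : c \in codomf hc by apply/codomfP; exists I.
  by rewrite inE.
exists B; split.
- split.
  + by move=> q; rewrite /= in_fset1U => /predU1P[->//|]; exact: VP.
  + split.
    * move=> q; rewrite /= in_fset1U /le' => /predU1P[->|qP]; first by rewrite (negbTE pP).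
      by rewrite qP Vr.
    * move=> q r; rewrite /= !in_fset1U /le' => /predU1P[->|qP] /predU1P[->|rP] //;
        rewrite ?(negbTE pP) ?qP ?rP ?andbF //=.
      exact: Va.
    * move=> r q t; rewrite /= !in_fset1U /le' => /predU1P[->|qP] /predU1P[->|rP] /predU1P[->|tP] //;
        rewrite ?(negbTE pP) ?qP ?rP ?tP ?andbF //=.
      exact: Vt.
    * move=> q r; rewrite /= !in_fset1U /le' => /predU1P[->|qP] /predU1P[->|rP] //;
        rewrite ?(negbTE pP) ?qP ?rP ?orbT //=.
      exact: Vtot.
  + apply/fsetP => I; rewrite dB in_fsetU.
    apply/orP/bigfcupP.
      move=> [/(colouredP _ VA)[r rP Ir]|IX].
        by exists r; rewrite ?asA // inE rP orbT.
      by exists p; rewrite ?asp // in_fset1U eqxx.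
    move=> [r]; rewrite andbT in_fset1U => /predU1P[->|rP]; first by rewrite asp => ?; right.
    by rewrite asA // => Ir; left; apply/(colouredP _ VA); exists r.
  + move=> q; rewrite /= in_fset1U => /predU1P[->|qP].
      exists J, [fset c in cs]; rewrite pbp asp; split=> //.
        split=> //.
        * move: J1; rewrite !inE => /or3P[->//|->|rP]; rewrite ?orbT //.
          by rewrite ltAp // rP !orbT.
        * move: J2; rewrite !inE => /or3P[->//|->|rP]; rewrite ?orbT //.
          by rewrite ltAp // rP !orbT.
        * move=> r; rewrite /= in_fset1U => /predU1P[->|rP _]; first by rewrite ltpp.
          exact: Jn.
      suff -> : pa_phi S B p = hc by [].
      apply/fmapP => I; rewrite fnd_restrict asp.
      by case: ifPn => IX; rewrite ?colX // not_fnd.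
    have [F [C [[F1 F2 qF nF] scC stC]]] := Vc q qP.
    have Eb : [fset r in pa_pillars B | pa_lt B r q] =
              [fset r in pa_pillars A | pa_lt A r q].
      apply/fsetP => r; rewrite !inE /=.
      have [->|nrp] := eqVneq r p; first by rewrite ltpA // (negbTE pP).
      by case rP: (r \in pa_pillars A); rewrite //= ltAA.
    exists F, C; rewrite pbB // asA //; split=> //.
      split; rewrite ?Eb //.
      move=> r; rewrite /= in_fset1U => /predU1P[->|rP]; first by rewrite ltpA.
      by rewrite ltAA //; exact: nF.
    suff -> : pa_phi S B q = pa_phi S A q by [].
    apply/fmapP => I; rewrite !fnd_restrict asA //.
    by case: ifPn => // Iq; exact/colA/(asnX q).
- split=> /=.
  + exact: fsubsetU1.
  + move=> q r qP; rewrite in_fsetD in_fset1U => /andP[rP /predU1P[->|]]; first exact: ltAp.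
    by rewrite (negbTE rP).
  + by move=> q r qP rP; rewrite /le' qP rP.
  + move=> I c Ic; rewrite -Ic; apply: colA.
    by apply: contraTN (domf_fnd Ic) => /XnA.
- by [].
- exact: dB.
- split.
    have <- : #|` [fset c in cs]| = omega X.
      rewrite card_fseq undup_id //.
      by move: scs; rewrite ltn_sorted_uniq_leq => /andP[].
    apply: fsubset_leq_card; apply/fsubsetP => c /in_codomf_restrict[I IX Ic].
    by rewrite inE; exact: hsub Ic.
  move=> I c IX /(hsub _ _ IX) cc; rewrite cs0 //=.
  apply: leq_trans (csb _ cc) _; rewrite leq_add2r.
  (* A crossing interval has an endpoint in [J], so [degree] counts its colour. *)
  apply: fsubset_leq_card; apply/fsubsetP => d /in_codomf_restrict[K KJ Kd].
  apply/in_codomf_restrict; exists K => //.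
  by move: KJ; rewrite !in_fset_sep => /andP[->]; case: (K.1 \in oitv J).
Qed.

Lemma degree_le_insert A B X L : extends A B ->
  domf (pa_col B) = domf (pa_col A) `|` X ->
  (degree S B L <= degree S A L + #|` codomf (pa_col B).[& X]|)%N.
Proof.
move=> [_ _ _ cAB] dB.
apply: leq_trans (leq_of_leqif (leq_card_fsetU _ _)).
apply: fsubset_leq_card; apply/fsubsetP => c /in_codomf_restrict[I IL Ic].
rewrite inE; apply/orP.
have := domf_fnd Ic; rewrite dB inE => /orP[IA|IX]; [left|right];
  apply/in_codomf_restrict; exists I => //.
by have [c' Ic'] := fnd_domf IA; rewrite Ic' -Ic (cAB _ _ Ic').
Qed.

(** Both endpoints of a new interval lie in the closure of [J], which is disjoint from the open
    interval [L]. *)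
Lemma degree_eq_insert A B X J L : extends A B ->
  domf (pa_col B) = domf (pa_col A) `|` X ->
  (forall I, I \in X -> J.1 <= I.1 /\ I.2 <= J.2) ->
  L.2 <= J.1 \/ J.2 <= L.1 -> degree S B L = degree S A L.
Proof.
move=> [_ _ _ cAB] dB XJ LJ.
rewrite /degree; congr (size (enum_fset _)).
apply/fsetP => c; apply/in_codomf_restrict/in_codomf_restrict => -[I IL Ic];
  exists I => //; last exact: cAB.
have := domf_fnd Ic; rewrite dB inE => /orP[IA|IX].
  by have [c' Ic'] := fnd_domf IA; rewrite Ic' -Ic (cAB _ _ Ic').
have [a b] := XJ I IX.
move: IL; rewrite in_fset_sep => /andP[IS]; have [_ l _] := HS.1 _ IS.
by rewrite !in_itv /=; case: LJ => ? /orP[] /andP[? ?]; exfalso; clear Ic dB; lra.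
Qed.

End InsertPillar.

Lemma pairwise_or (T : eqType) (r : rel T) (s : seq T) x y :
  pairwise r s -> x \in s -> y \in s -> x != y -> r x y || r y x.
Proof.
move=> ps xs ys nxy.
apply: (@pairwise_in _ [rel u v | r u v || r v u] s) => //.
  by move=> u v /=; rewrite orbC.
by apply: sub_pairwise ps => u v /= ->.
Qed.

(** * Coloured intervals seen from one arch *)

Section Arch.
Variables (R : realType) (S : {fset R * R}) (A : assignment R) (K : R * R).
Hypothesis HS : interval_system S.
Hypothesis VA : pillar_assignment S A.
Hypothesis aK : arch A K.
Implicit Types (I J : R * R) (p q : R).

Notation P := (pa_pillars A).

Definition colour I : nat := odflt 0%N (pa_col A).[? I].

(** In a pillar assignment a coloured interval is assigned to exactly one pillar; only uncoloured
    intervals get the default [0]. *)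
Definition pillar_of I : R := head 0 [seq p <- P | I \in assigned S A p].

(* The coloured intervals with an endpoint in the arch, and that endpoint: the
   other one lies outside, as the interval contains a pillar. *)
Definition entering : {fset R * R} :=
  [fset I in domf (pa_col A) | (I.1 \in oitv K) || (I.2 \in oitv K)].

Definition end_in I : R := if I.1 \in oitv K then I.1 else I.2.

Lemma pa_lt_trans p q r : p \in P -> q \in P -> r \in P ->
  pa_lt A p q -> pa_lt A q r -> pa_lt A p r.
Proof.
move: VA => [_ [_ Va Vt _] _ _] pP qP rP /andP[npq pq] /andP[nqr qr].
rewrite /pa_lt (Vt q p r) // andbT; apply: contra npq => /eqP E.
by apply/eqP/Va; rewrite // pq E qr.
Qed.

Lemma pa_lt_total p q : p \in P -> q \in P -> p != q -> pa_lt A p q || pa_lt A q p.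
Proof.
move: VA => [_ [_ _ _ Vtot] _ _] pP qP npq.
by rewrite /pa_lt npq eq_sym npq /=; exact: Vtot.
Qed.

Lemma coloured_in_S I : I \in domf (pa_col A) -> I \in S.
Proof. by move=> /(colouredP _ VA)[p _ /assignedP[]]. Qed.

Lemma colourE I c : (pa_col A).[? I] = Some c -> colour I = c.
Proof. by rewrite /colour => ->. Qed.

Lemma fnd_colour I : I \in domf (pa_col A) -> (pa_col A).[? I] = Some (colour I).
Proof. by move=> /fnd_domf[c Ic]; rewrite (colourE Ic). Qed.

Lemma pillar_ofP I : I \in domf (pa_col A) ->
  pillar_of I \in P /\ I \in assigned S A (pillar_of I).
Proof.
move=> /(colouredP _ VA)[p pP Ip].
have : pillar_of I \in [seq p <- P | I \in assigned S A p].
  have : p \in [seq p <- P | I \in assigned S A p] by rewrite mem_filter Ip.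
  by rewrite /pillar_of; case: (filter _ _) => // q s _; rewrite mem_head.
by rewrite mem_filter => /andP[].
Qed.

(** Of two pillars inside [I], the earlier one blocks assignment to the later. *)
Lemma pillar_of_assigned p I : p \in P -> I \in assigned S A p -> pillar_of I = p.
Proof.
move=> pP Ip; have Id : I \in domf (pa_col A) by apply/(colouredP _ VA); exists p.
have [qP Iq] := pillar_ofP Id; apply/eqP; apply/negPn/negP => n.
move: Ip Iq => /assignedP[_ pI Hp] /assignedP[_ qI Hq].
have /orP[l|l] := pa_lt_total qP pP n.
  by have := Hp _ qP l; rewrite qI.
by have := Hq _ pP l; rewrite pI.
Qed.

(** The pillar lies in the interval but outside the arch: to the right if the left endpoint enters,
    to the left if the right one does. *)
Lemma enteringP I : I \in entering ->
  [/\ I \in domf (pa_col A), pillar_of I \in P, I.1 < pillar_of I < I.2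
    & forall q, q \in P -> pa_lt A q (pillar_of I) -> ~~ (I.1 < q < I.2)] /\
  ((K.1 < I.1 < K.2) /\ K.2 <= pillar_of I /\ end_in I = I.1 \/
   (K.1 < I.2 < K.2) /\ pillar_of I <= K.1 /\ end_in I = I.2).
Proof.
rewrite in_fset_sep => /andP[Id IK].
have [qP /assignedP[_]] := pillar_ofP Id.
rewrite in_itv /= => pI Hq; split.
  by split=> // q qP' l; have := Hq q qP' l; rewrite in_itv.
have [_ _ _ /(_ _ qP)] := aK; rewrite in_itv /= => nK.
rewrite /end_in; move: IK; rewrite !in_itv /=.
have [I1 _|nI1 /= I2] := boolP (K.1 < I.1 < K.2); [left|right].
  by split=> //; split=> //; lra.
by split=> //; split=> //; lra.
Qed.

Lemma entering_end I : I \in entering -> K.1 < end_in I < K.2.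
Proof. by move=> /enteringP[_ [[? [_ ->]]|[? [_ ->]]]]. Qed.

(* The pillars to the right of the arch in decreasing order, followed by those
   to the left in increasing order. *)
Definition pillar_before p q : bool :=
  if K.2 <= p then (if K.2 <= q then pa_lt A q p else true)
  else (q < K.2) && pa_lt A p q.

Lemma pillar_before_irr p : pillar_before p p = false.
Proof. by rewrite /pillar_before /pa_lt eqxx /= andbF; case: (K.2 <= p). Qed.

Lemma pillar_before_trans p q r : p \in P -> q \in P -> r \in P ->
  pillar_before p q -> pillar_before q r -> pillar_before p r.
Proof.
move=> pP qP rP; rewrite /pillar_before !ltNge.
case: (K.2 <= p); case: (K.2 <= q); case: (K.2 <= r) => //=.
- by move=> a b; exact: pa_lt_trans b a.
- exact: pa_lt_trans.
Qed.

Lemma pillar_before_total p q : p \in P -> q \in P -> p != q ->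
  pillar_before p q || pillar_before q p.
Proof.
move=> pP qP n; rewrite /pillar_before !ltNge.
case: (K.2 <= p); case: (K.2 <= q) => //=; last exact: pa_lt_total.
by rewrite orbC; exact: pa_lt_total.
Qed.

(** On one side of the arch, the interval of the later pillar stops short of the earlier pillar,
    which orders the far endpoints. On opposite sides, the intervals extend towards each other and
    meet between their ends in the arch. *)
Lemma entering_overlaps I J : I \in entering -> J \in entering ->
  pillar_before (pillar_of I) (pillar_of J) -> end_in I < end_in J ->
  overlaps I J.
Proof.
move=> /enteringP[[_ pP pI nI] cI] /enteringP[[_ qP qJ nJ] cJ].
case: cI => -[IK [pK ->]]; case: cJ => -[JK [qK ->]]; rewrite /pillar_before.
- rewrite pK qK => /(nI _ qP) n l; apply: crosses_overlaps; apply/and3P.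
  by split; lra.
- move=> _ l; rewrite overlaps_sym; apply: crosses_overlaps; apply/and3P.
  by split; lra.
- rewrite leNgt; have -> : pillar_of I < K.2 by lra.
  by rewrite /= (ltNge _ K.2) qK.
- rewrite leNgt; have -> : pillar_of I < K.2 by lra.
  move=> /andP[_] /(nJ _ pP) n l; apply: crosses_overlaps; apply/and3P.
  by split; lra.
Qed.

(** The foundation of the later pillar contains the arch, since an earlier pillar between the two
    would lie in [J]. It omits the earlier pillar, so [I] has exactly one endpoint in it and the
    colour of [I] is forbidden for [J]. *)
Lemma entering_colour_pillar_lt I J : I \in entering -> J \in entering ->
  pa_lt A (pillar_of I) (pillar_of J) -> colour I != colour J.
Proof.
move=> IE JE lt; have [[Id pP pI nI] cI] := enteringP IE.
have [[Jd qP qJ nJ] cJ] := enteringP JE.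
have [_ Jq] := pillar_ofP Jd; have [_ Ip] := pillar_ofP Id.
have [VP _ _ Vc] := VA.
have [F [C [[F1 F2 qF nF] [_ Cn _] [_ _ [_ /fsubsetP HC] _ _]]]] := Vc _ qP.
have JC : colour J \in C.
  apply: HC; apply/in_codomf_restrict; exists J => //; exact: fnd_colour.
apply: contraTneq JC => <-; apply/negP => /Cn[_ /negP]; apply.
apply/in_codomf_restrict; exists I; last first.
  rewrite fnd_restrict; case: ifPn; first by rewrite fnd_colour.
  by move=> /negP[]; apply/bigfcupP; exists (pillar_of I) => //; rewrite pP.
have [K12 K1 K2 nK] := aK.
have P01 r : r \in P -> 0 < r < 1 by move=> /VP[].
have b01 r : r \in 0 |` (1 |` P) -> 0 <= r <= 1.
  by rewrite !in_fset1U => /or3P[/eqP->|/eqP->|/P01]; lra.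
have K1b := b01 _ K1; have K2b := b01 _ K2.
have q01 := P01 _ qP.
move: qF; rewrite in_itv /= => qF.
have pF := nF _ pP lt; rewrite in_itv /= in pF.
have FK1 : F.1 <= K.1.
  rewrite leNgt; apply/negP => l.
  move: F1; rewrite !in_fset1U in_fset_sep => /or3P[/eqP E|/eqP E|/andP[FP Fl]].
  - by lra.
  - by lra.
  have := nJ _ FP Fl; have := nK _ FP; rewrite in_itv /= => n1 n2.
  by case: cJ => -[a [b _]]; lra.
have FK2 : K.2 <= F.2.
  rewrite leNgt; apply/negP => l.
  move: F2; rewrite !in_fset1U in_fset_sep => /or3P[/eqP E|/eqP E|/andP[FP Fl]].
  - by lra.
  - by lra.
  have := nJ _ FP Fl; have := nK _ FP; rewrite in_itv /= => n1 n2.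
  by case: cJ => -[a [b _]]; lra.
rewrite in_fset_sep coloured_in_S //= !in_itv /=.
case: cI => -[a [b _]].
  have -> : F.1 < I.1 < F.2 by lra.
  by apply/negP; lra.
have -> : F.1 < I.2 < F.2 by lra.
by rewrite addbT; apply/negP; lra.
Qed.

Lemma entering_colour_pillar I J : I \in entering -> J \in entering ->
  pillar_of I != pillar_of J -> colour I != colour J.
Proof.
move=> IE JE n; have [[_ pP _ _] _] := enteringP IE.
have [[_ qP _ _] _] := enteringP JE.
have /orP[l|l] := pa_lt_total pP qP n; first exact: entering_colour_pillar_lt.
by rewrite eq_sym; exact: entering_colour_pillar_lt.
Qed.

(** Entering intervals with different pillars differ in colour, so this amounts to a strict order on
    the colours seen from the arch, by pillar and then by value. *)
Definition key_lt I J : bool :=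
  pillar_before (pillar_of I) (pillar_of J) ||
  (pillar_of I == pillar_of J) && (colour I < colour J)%N.

Lemma key_lt_trans I J L : I \in entering -> J \in entering -> L \in entering ->
  key_lt I J -> key_lt J L -> key_lt I L.
Proof.
move=> /enteringP[[_ pP _ _] _] /enteringP[[_ qP _ _] _] /enteringP[[_ rP _ _] _].
rewrite /key_lt => /orP[a|/andP[/eqP-> a]] /orP[b|/andP[/eqP<- b]].
- by rewrite (pillar_before_trans pP qP rP a b).
- by rewrite a.
- by rewrite b.
- by rewrite eqxx (ltn_trans a b) orbT.
Qed.

Lemma key_lt_colour I J : I \in entering -> J \in entering ->
  key_lt I J -> colour I != colour J.
Proof.
move=> IE JE /orP[l|/andP[_ l]]; last by rewrite ltn_eqF.
apply: entering_colour_pillar => //.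
by apply: contraTneq l => ->; rewrite pillar_before_irr.
Qed.

Lemma key_lt_total I J : I \in entering -> J \in entering ->
  colour I != colour J -> key_lt I J || key_lt J I.
Proof.
move=> IE JE n; have [[_ pP _ _] _] := enteringP IE.
have [[_ qP _ _] _] := enteringP JE; rewrite /key_lt.
have [E|np] := eqVneq (pillar_of I) (pillar_of J).
  by rewrite E pillar_before_irr /= -neq_ltn.
by case/orP: (pillar_before_total pP qP np) => ->; rewrite ?orbT.
Qed.

(** The position, counted from [0], of the colour of [I] among those seen from the arch. *)
Definition rank I : nat :=
  #|` [fset colour J | J in [fset L in entering | key_lt L I]] |.

(** The colour of [I] counts for the degree but not for its own rank. *)
Lemma rank_lt_degree I : I \in entering -> (rank I < degree S A K)%N.
Proof.
move=> IE; apply: fproper_ltn_card; rewrite fproperE; apply/andP; split.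
  apply/fsubsetP => c /imfsetP[J /=]; rewrite in_fset_sep => /andP[JE _] ->.
  move: JE; rewrite in_fset_sep => /andP[Jd JK].
  apply/in_codomf_restrict; exists J; last exact: fnd_colour.
  by rewrite in_fset_sep coloured_in_S.
apply/fsubsetPn; exists (colour I).
  move: IE; rewrite in_fset_sep => /andP[Id IK].
  apply/in_codomf_restrict; exists I; last exact: fnd_colour.
  by rewrite in_fset_sep coloured_in_S.
apply/imfsetP => -[J /=]; rewrite in_fset_sep => /andP[JE l] /eqP.
by rewrite eq_sym (negbTE (key_lt_colour JE IE l)).
Qed.

Lemma key_lt_rank I J : I \in entering -> J \in entering ->
  key_lt I J -> (rank I < rank J)%N.
Proof.
move=> IE JE l; apply: fproper_ltn_card; rewrite fproperE; apply/andP; split.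
  apply/fsubsetP => c /imfsetP[L /=]; rewrite in_fset_sep => /andP[LE lL] ->.
  by apply: in_imfset; rewrite /= in_fset_sep LE (key_lt_trans LE IE JE).
apply/fsubsetPn; exists (colour I).
  by apply: in_imfset; rewrite /= in_fset_sep IE.
apply/imfsetP => -[L /=]; rewrite in_fset_sep => /andP[LE lL] /eqP.
by rewrite eq_sym (negbTE (key_lt_colour LE IE lL)).
Qed.

Lemma rank_key_lt I J : I \in entering -> J \in entering ->
  (rank I < rank J)%N -> key_lt I J.
Proof.
move=> IE JE l; have [E|n] := eqVneq (colour I) (colour J); last first.
  case/orP: (key_lt_total IE JE n) => // /(key_lt_rank JE IE).
  by rewrite ltnNge (ltnW l).
have [Ep|np] := eqVneq (pillar_of I) (pillar_of J).
  by move: l; rewrite /rank /key_lt E Ep ltnn.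
by have := entering_colour_pillar IE JE np; rewrite E eqxx.
Qed.

Lemma rank_eq_colour I J : I \in entering -> J \in entering ->
  rank I = rank J -> colour I = colour J.
Proof.
move=> IE JE E; apply/eqP/negPn/negP => n.
case/orP: (key_lt_total IE JE n) => l.
  by have := key_lt_rank IE JE l; rewrite E ltnn.
by have := key_lt_rank JE IE l; rewrite E ltnn.
Qed.

Lemma structured_wrt_seq (endpt : R * R -> R) p (s : seq (R * R)) :
  structured_wrt endpt (assigned S A p) (pa_phi S A p) ->
  {subset s <= assigned S A p} -> {subset s <= domf (pa_col A)} ->
  pairwise (fun I J => (colour I < colour J)%N && (endpt I < endpt J)) s ->
  exists t, [/\ size t = size s, {subset t <= assigned S A p},
    pairwise (@overlaps R) t
    & forall L, L \in t -> exists I J,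
        [/\ I \in s, J \in s & endpt I <= endpt L <= endpt J]].
Proof.
(* The empty sequence is apart because [structured_wrt] speaks of [k.+1] intervals. *)
case: s => [|x s'] Hst; first by exists [::].
set s := x :: s' => ss sd /(pairwiseP x) ps.
have szs : size s = (size s').+1 by [].
have ns (j : 'I_(size s').+1) : nth x s j \in s by apply: mem_nth; rewrite szs.
have [] := Hst (size s') (fun j => nth x s j) (fun j => colour (nth x s j)).
- by move=> j; exact: ss.
- by move=> j; rewrite fnd_restrict ss // fnd_colour // sd.
- by move=> i j ij; have /andP[] := ps i j (ltn_ord i) (ltn_ord j) ij.
- by move=> i j ij; have /andP[] := ps i j (ltn_ord i) (ltn_ord j) ij.
move=> I' [I'a I'o I'e]; exists (map I' (enum 'I_(size s').+1)); split.
- by rewrite size_map size_enum_ord.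
- by move=> _ /mapP[j _ ->].
- rewrite pairwise_map; have := enum_uniq 'I_(size s').+1; rewrite uniq_pairwise.
  by apply: sub_pairwise => i j /= nij; apply/asboolP/I'o.
- move=> _ /mapP[j _ ->]; exists (nth x s (@ord0 (size s'))), (nth x s (@ord_max (size s'))).
  by split.
Qed.

(** Intervals with one pillar enter the arch from the same side, so [end_in] is the left endpoint on
    all of them or the right one on all, and one of the two structured conditions applies. The
    clique has its endpoints between entering ones, hence it enters too. *)
Lemma run_clique (p : R) (s : seq (R * R)) : p \in P ->
  {subset s <= entering} -> (forall I, I \in s -> pillar_of I = p) ->
  pairwise (fun I J => key_lt I J && (end_in I < end_in J)) s ->
  exists t, [/\ size t = size s, {subset t <= entering},
    pairwise (@overlaps R) t
    & forall L, L \in t -> pillar_of L = p /\ exists I J,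
        [/\ I \in s, J \in s & end_in I <= end_in L <= end_in J]].
Proof.
move=> pP sE sp ps; have [VP _ _ Vc] := VA.
have [F [C [_ _ [_ _ _ _ [st1 st2]]]]] := Vc _ pP.
have sd : {subset s <= domf (pa_col A)} by move=> I /sE /enteringP[[]].
have sa : {subset s <= assigned S A p}.
  by move=> I Is; have [_] := pillar_ofP (sd I Is); rewrite sp.
have [K12 _ _ /(_ _ pP)] := aK; rewrite in_itv /= => nK.
have go endpt : structured_wrt endpt (assigned S A p) (pa_phi S A p) ->
    (forall I, I \in s -> end_in I = endpt I) ->
    (forall L, L \in assigned S A p -> K.1 < endpt L < K.2 ->
       L \in entering /\ end_in L = endpt L) ->
  exists t, [/\ size t = size s, {subset t <= entering},
    pairwise (@overlaps R) t
    & forall L, L \in t -> pillar_of L = p /\ exists I J,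
        [/\ I \in s, J \in s & end_in I <= end_in L <= end_in J]].
  move=> st es eL; have [] := structured_wrt_seq st sa sd.
    apply: (@sub_in_pairwise _ (mem s) _ _ _ _ _ ps); last exact/allP.
    move=> I J Is Js /= /andP[/orP[|/andP[_ ->]]]; last by rewrite !es.
    by rewrite !sp // pillar_before_irr.
  move=> t [szt ta pt te]; exists t.
  have key L : L \in t -> L \in entering /\ end_in L = endpt L.
    move=> Lt; have [I [J [Is Js]]] := te L Lt; rewrite -(es I Is) -(es J Js) => IJ.
    have := entering_end (sE I Is); have := entering_end (sE J Js).
    by move=> a b; apply: eL; [exact: ta | lra].
  split=> //; first by move=> L /key[].
  move=> L Lt; split; first exact/pillar_of_assigned/ta.
  have [I [J [Is Js IJ]]] := te L Lt.
  by exists I, J; rewrite (es I Is) (es J Js) (key L Lt).2.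
have memE L : L \in assigned S A p -> (L.1 \in oitv K) || (L.2 \in oitv K) ->
    L \in entering.
  move=> La LK; rewrite in_fset_sep LK andbT; apply/(colouredP _ VA).
  by exists p.
have [Kp|pK] := leP K.2 p.
  apply: (go fst) => //.
    move=> I Is; have [_ [[_ [_ ->]]|[a [b _]]]] := enteringP (sE I Is) => //.
    by move: b; rewrite sp // => b; exfalso; lra.
  move=> L La LK; split; last by rewrite /end_in in_itv /= LK.
  by apply: memE; rewrite // in_itv /= LK.
have pK1 : p <= K.1 by lra.
apply: (go snd) => //.
  move=> I Is; have [_ [[a [b _]]|[_ [_ ->]]]] := enteringP (sE I Is) => //.
  by move: b; rewrite sp // => b; exfalso; lra.
move=> L La LK; split; first by apply: memE; rewrite // !in_itv /= LK orbT.
rewrite /end_in; case: ifP => //; rewrite in_itv /= => L1.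
by move: La => /assignedP[_]; rewrite in_itv /= => ? _; exfalso; lra.
Qed.

(* Intervals with the same pillar are handled by the structured colourings,
   intervals with different pillars overlap. *)
Lemma chain_clique (s : seq (R * R)) : {subset s <= entering} ->
  pairwise (fun I J => key_lt I J && (end_in I < end_in J)) s ->
  exists t, [/\ size t = size s, {subset t <= entering},
    pairwise (@overlaps R) t
    & forall L, L \in t -> (exists2 I, I \in s & pillar_of L = pillar_of I) /\
        exists I J, [/\ I \in s, J \in s & end_in I <= end_in L <= end_in J]].
Proof.
have [n] := ubnP (size s); elim: n s => // n IH [_ _ _|x s' szs sE ps].
  by exists [::].
set s := x :: s' in szs sE ps *.
have xs : x \in s by exact: mem_head.
(* The intervals with the first pillar form one run; the induction treats the others. *)
pose a := [pred I | pillar_of I == pillar_of x].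
have [[xd xP _ _] _] := enteringP (sE x xs).
have sub b : {subset filter b s <= s} by move=> I; rewrite mem_filter => /andP[].
have pf b : pairwise (fun I J => key_lt I J && (end_in I < end_in J)) (filter b s).
  exact: subseq_pairwise (filter_subseq _ _) ps.
have [t1 [sz1 t1E pt1 t1s]] : exists t, [/\ size t = size (filter a s),
    {subset t <= entering}, pairwise (@overlaps R) t
    & forall L, L \in t -> pillar_of L = pillar_of x /\ exists I J,
      [/\ I \in filter a s, J \in filter a s & end_in I <= end_in L <= end_in J]].
  apply: run_clique => //; first by move=> I /sub /sE.
  by move=> I; rewrite mem_filter => /andP[/eqP].
have [] := IH (filter (predC a) s) _ _ (pf _).
- rewrite size_filter -ltnS; apply: leq_trans szs; rewrite ltnS.
  by rewrite -(count_predC a s) -add1n leq_add2r /= eqxx.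
- by move=> I /sub /sE.
move=> t2 [sz2 t2E pt2 t2s].
(* Pillars never go back along the sequence, so the run precedes the rest in position as well. *)
have order I J : I \in filter a s -> J \in filter (predC a) s ->
    pillar_before (pillar_of x) (pillar_of J) /\ end_in I < end_in J.
  rewrite !mem_filter /= => /andP[/eqP EI Is] /andP[nJ Js].
  have [[_ JP _ _] _] := enteringP (sE J Js).
  have nxJ : x != J by apply: contraNneq nJ => ->.
  have nIJ : I != J by apply: contraNneq nJ => <-; rewrite EI.
  have xJ : pillar_before (pillar_of x) (pillar_of J).
    move: ps => /= /andP[/allP /(_ J)]; have := Js.
    rewrite inE eq_sym (negbTE nxJ) /= => -> /(_ isT) /andP[/orP[//|/andP[/eqP E]]].
    by rewrite E eqxx in nJ.
  split=> //; have /orP[/andP[_ //]|/andP[/orP[Jx|/andP[/eqP E _]] _]] :=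
    pairwise_or ps Is Js nIJ.
    rewrite EI in Jx; have := pillar_before_trans xP JP xP xJ Jx.
    by rewrite pillar_before_irr.
  by rewrite E EI eqxx in nJ.
exists (t1 ++ t2); split.
- by rewrite size_cat sz1 sz2 !size_filter count_predC.
- by move=> I; rewrite mem_cat => /orP[/t1E|/t2E].
- rewrite pairwise_cat pt1 pt2 /= andbT; apply/allrelP => I J It Jt.
  (* The new endpoints stay within the ranges of the run and of the rest, so they keep the order
     that gives overlap. *)
  have [EI [_ [I2 [_ I2s /andP[_ I2e]]]]] := t1s I It.
  have [[M Ms EM] [J1 [_ [J1s _ /andP[J1e _]]]]] := t2s J Jt.
  apply: entering_overlaps; [exact: t1E|exact: t2E| |].
    rewrite EI EM; have [] := order x M => //.
    by rewrite mem_filter /= eqxx.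
  by have [_ l] := order I2 J1 I2s J1s; lra.
- move=> L; rewrite mem_cat => /orP[/t1s|/t2s].
    move=> [E [I [J [/sub Is /sub Js IJ]]]]; split; first by exists x.
    by exists I, J.
  move=> [[M /sub Ms EM] [I [J [/sub Is /sub Js IJ]]]]; split; first by exists M.
  by exists I, J.
Qed.

Lemma chain_size (s : seq (R * R)) : {subset s <= entering} ->
  pairwise (fun I J => (rank I < rank J)%N && (end_in I < end_in J)) s ->
  (size s <= omega S)%N.
Proof.
move=> sE ps; have [|t [<- tE pt _]] := chain_clique sE.
  apply: (@sub_in_pairwise _ (mem s) _ _ _ _ _ ps); last exact/allP.
  by move=> I J Is Js /= /andP[l ->]; rewrite rank_key_lt ?sE.
by apply: omega_ge => // I /tE /enteringP[[/coloured_in_S]].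
Qed.

End Arch.

(** * Cut points, pigeonhole and choice of representatives *)

Lemma gap_pillars (R : realType) (S : {fset R * R}) : exists g : R -> R,
  forall e, 0 < e -> 0 < g e < e /\
    forall I, I \in S -> (I.1 < e -> I.1 < g e) /\ (I.2 < e -> I.2 < g e).
Proof.
suff H e : exists y, 0 < e -> 0 < y < e /\
    forall I, I \in S -> (I.1 < e -> I.1 < y) /\ (I.2 < e -> I.2 < y).
  by have [g Hg] := choice H; exists g.
have [e0|e0] := leP e 0; first by exists 0 => e0'; lra.
(* The cut goes halfway between [e] and the last endpoint before it; the seed [0] keeps it
   positive. *)
pose s := 0 :: [seq x <- map fst S ++ map snd S | x < e].
have [m ms Hm] := seq_max id (mem_head 0 _ : 0 \in s).
have me : m < e.
  by move: ms; rewrite inE mem_filter => /predU1P[->//|/andP[]].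
have m0 : 0 <= m by apply: Hm; exact: mem_head.
exists ((m + e) / 2) => _; split; first by lra.
move=> I IS; split=> l.
  have : I.1 <= m.
    by apply: Hm; rewrite inE mem_filter l mem_cat map_f ?orbT.
  by lra.
have : I.2 <= m.
  by apply: Hm; rewrite inE mem_filter l mem_cat [X in _ || (_ && X)]orbC map_f ?orbT.
by lra.
Qed.

Lemma count_pigeonhole n m (l : seq nat) :
  (forall x, x \in l -> (x < n)%N) -> (n * m < size l)%N ->
  exists d, (m < count_mem d l)%N.
Proof.
elim: n l => [|n IH] l ln szl.
  by case: l ln szl => // x l /(_ x (mem_head _ _)).
have [lt|le] := ltnP m (count_mem n l); first by exists n.
have [] := IH [seq x <- l | x != n].
- move=> x; rewrite mem_filter => /andP[xn /ln]; rewrite ltnS leq_eqVlt.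
  by rewrite (negbTE xn).
- rewrite size_filter.
  have -> : count [pred x | x != n] l = count (predC (pred1 n)) l by [].
  move: szl le; rewrite -(count_predC (pred1 n) l) mulSn.
  by move: (count _ _) (count _ _) => a b; lia.
- move=> d md; exists d; apply: leq_trans md _.
  by rewrite count_filter; apply: sub_count => x /andP[].
Qed.

Lemma imfset_choose (T U : choiceType) (f : T -> U) (D : {fset T}) (l : seq U) :
  {subset l <= [fset f x | x in D]} ->
  exists s, {subset s <= D} /\ map f s = l.
Proof.
elim: l => [|y l IH] Hl; first by exists [::].
have [|s [sD Es]] := IH; first by move=> x xl; apply: Hl; rewrite inE xl orbT.
have /imfsetP[x xD ->] := Hl y (mem_head _ _).
exists (x :: s); split; last by rewrite /= Es.
by move=> z; rewrite inE => /predU1P[->|/sD].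
Qed.

(** * Cutting an arch into segments with few colours *)

Section Cuts.
Variables (R : realType) (S : {fset R * R}) (A : assignment R) (K : R * R).
Hypothesis HS : interval_system S.
Hypothesis VA : pillar_assignment S A.
Hypothesis aK : arch A K.
Variable g : R -> R.
Hypothesis gP : forall e, 0 < e -> 0 < g e < e /\
  forall I, I \in S -> (I.1 < e -> I.1 < g e) /\ (I.2 < e -> I.2 < g e).
Implicit Types (I J L : R * R) (u v : R).

Notation E := (entering A K).
Notation endK := (end_in K).
Notation col := (colour A).

Lemma arch_bounds : 0 <= K.1 /\ K.2 <= 1.
Proof.
have [VP _ _ _] := VA; have [_ K1 K2 _] := aK.
have P01 r : r \in pa_pillars A -> 0 < r < 1 by move=> /VP[].
move: K1 K2; rewrite !in_fset1U => K1 K2.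
split; first by case/or3P: K1 => [/eqP->|/eqP->|/P01]; lra.
by case/or3P: K2 => [/eqP->|/eqP->|/P01]; lra.
Qed.

Lemma end_in_gt0 I : I \in E -> 0 < endK I.
Proof.
by move=> /(entering_end VA aK); have [] := arch_bounds; lra.
Qed.

Lemma end_in_cases I : endK I = I.1 \/ endK I = I.2.
Proof. by rewrite /end_in; case: ifP; [left|right]. Qed.

Lemma entering_S I : I \in E -> I \in S.
Proof. by rewrite in_fset_sep => /andP[/(coloured_in_S VA)]. Qed.

Lemma end_in_inj I J : I \in E -> J \in E -> endK I = endK J -> I = J.
Proof.
move=> IE JE; have [->//|n] := eqVneq I J.
have [n1 n2 n3 n4] := HS.2 _ _ (entering_S IE) (entering_S JE) n.
case: (end_in_cases I) => ->; case: (end_in_cases J) => -> /eqP;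
by rewrite ?(negbTE n1) ?(negbTE n2) ?(negbTE n3) ?(negbTE n4).
Qed.

Lemma end_in_gap I L : I \in E -> L \in E -> endK L < endK I -> endK L < g (endK I).
Proof.
move=> IE LE; have [_ /(_ L (entering_S LE))[a b]] := gP (end_in_gt0 IE).
by case: (end_in_cases L) => ->.
Qed.

Definition colours_in (Q : pred R) : {fset nat} :=
  [fset col J | J in [fset L in E | Q (endK L)]].

Lemma colours_inS (Q Q' : pred R) :
  (forall L, L \in E -> Q (endK L) -> Q' (endK L)) ->
  (#|` colours_in Q| <= #|` colours_in Q'|)%N.
Proof.
move=> QQ; apply: fsubset_leq_card; apply/fsubsetP => c /imfsetP[J /=].
rewrite in_fset_sep => /andP[JE JQ] ->.
by apply: in_imfset; rewrite /= in_fset_sep JE QQ.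
Qed.

(** The other endpoint of an entering interval lies outside the arch, so only the entering one can
    fall in a segment. *)
Lemma degree_colours_in u v : K.1 <= u -> v <= K.2 ->
  degree S A (u, v) = #|` colours_in (fun x => u < x < v)|.
Proof.
move=> Ku vK; rewrite /degree; congr (size (enum_fset _)).
apply/fsetP => c; apply/in_codomf_restrict/imfsetP => -[I].
  rewrite in_fset_sep !in_itv /= => /andP[IS Iuv] Ic.
  have Id := domf_fnd Ic.
  have IE : I \in E.
    rewrite in_fset_sep Id !in_itv /=.
    by case/orP: Iuv => ?; apply/orP; [left|right]; lra.
  exists I; last by rewrite (colourE Ic).
  rewrite /= in_fset_sep IE /=.
  by have [_ [[a [b ->]]|[a [b ->]]]] := enteringP VA aK IE;
    have [[_ _ ? _] _] := enteringP VA aK IE; case/orP: Iuv => ?; lra.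
rewrite /= in_fset_sep => /andP[IE Iuv] ->.
have Id : I \in domf (pa_col A) by move: IE; rewrite in_fset_sep => /andP[].
exists I; last exact: fnd_colour.
rewrite in_fset_sep entering_S //= !in_itv /=.
by case: (end_in_cases I) Iuv => -> ->; rewrite ?orbT.
Qed.

(* At most [k] successive cuts, each just before an entering endpoint, leave
   segments with at most seven colours. *)
Fixpoint cuttable k u v : Prop :=
  (degree S A (u, v) <= 7)%N \/
  if k is k'.+1 then exists I,
    [/\ I \in E, u < g (endK I), endK I < v,
        (degree S A (u, g (endK I)) <= 7)%N & cuttable k' (g (endK I)) v]
  else False.

Lemma cuttable_degree k u v : (degree S A (u, v) <= 7)%N -> cuttable k u v.
Proof. by case: k; left. Qed.

(** The cut that follows the first [a] ones becomes the root of a binary tree; if the cuts end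
    sooner, [a] of them suffice. *)
Lemma cuttable_split a b u v : cuttable (a + b).+1 u v ->
  cuttable a u v \/ exists I,
    [/\ I \in E, u < g (endK I), endK I < v,
        cuttable a u (g (endK I)) & cuttable b (g (endK I)) v].
Proof.
elim: a u => [|a IH] u [d|[I [IE ug ev d c]]].
- by left; left.
- by right; exists I; split=> //; left.
- by left; left.
have [ca|[J [JE gg ev' ca cb]]] := IH _ c.
  by left; right; exists I.
right; exists J; split=> //; first exact: lt_trans gg.
right; exists I; split=> //.
(* The order of the two cuts forces [endK I < endK J], and no entering endpoint lies in between
   [g (endK J)] and [endK J]. *)
have [/andP[_ gI] _] := gP (end_in_gt0 IE).
have [/andP[_ gJ] _] := gP (end_in_gt0 JE).
apply: (end_in_gap JE IE).
have [//|l|E] := ltgtP (endK I) (endK J); last by rewrite E ltxx in gg.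
by have := end_in_gap IE JE l; lra.
Qed.

(* The consecutive segments, each with at least eight colours, overlap in at
   most one endpoint. *)
Fixpoint fat k u v : Prop :=
  if k is k'.+1 then exists I,
    [/\ I \in E, u < endK I < v,
        (7 < #|` colours_in (fun x => (u < x <= endK I)%R)|)%N & fat k' (g (endK I)) v]
  else True.

(** The cut is made before the first entering endpoint at which the colours met since [u] reach
    eight; by minimality at most seven are met before the cut. *)
Lemma first_cut u v : K.1 <= u -> v <= K.2 -> (7 < degree S A (u, v))%N ->
  exists I, [/\ I \in E, u < g (endK I), endK I < v,
    (degree S A (u, g (endK I)) <= 7)%N
    & (7 < #|` colours_in (fun x => (u < x <= endK I)%R)|)%N].
Proof.
move=> Ku vK d.
(* The last entering endpoint before [w] closes a half-open segment with the same colours. *)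
have last_end w : (7 < #|` colours_in (fun x => (u < x < w)%R)|)%N -> exists I,
    [/\ I \in E, u < endK I < w & (7 < #|` colours_in (fun x => (u < x <= endK I)%R)|)%N].
  move=> dw.
  have [c /imfsetP[J /=]] : exists c, c \in colours_in (fun x => u < x < w).
    by apply/fset0Pn; rewrite -cardfs_gt0; apply: leq_trans dw.
  move=> /(seq_max endK)[I]; rewrite in_fset_sep => /andP[IE Iw] HI _.
  exists I; split=> //; apply: leq_trans dw _.
  apply: colours_inS => L LE /andP[uL Lw]; rewrite uL HI //.
  by rewrite in_fset_sep LE uL.
rewrite degree_colours_in // in d.
pose C := [fset L in E | (u < endK L < v) &&
  (7 < #|` colours_in (fun x => (u < x <= endK L)%R)|)%N].
have [I0 [I0E I0v I0c]] := last_end v d.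
have [I] : exists2 I, I \in C & forall J, J \in C -> endK I <= endK J.
  by apply: (@seq_min _ _ _ _ I0); rewrite in_fset_sep I0E I0v.
rewrite in_fset_sep => /and3P[IE /andP[uI Iv] Ic] Imin.
have [/andP[_ gI] _] := gP (end_in_gt0 IE).
exists I; split=> //.
  (* With the cut at or before [u], only the endpoint of [I] would lie in the segment, giving a
     single colour. *)
  rewrite ltNge; apply/negP => gu.
  move: Ic; apply/negP; rewrite -leqNgt; apply: (@leq_trans 1) => //.
  rewrite -(cardfs1 (col I)); apply: fsubset_leq_card; apply/fsubsetP => c.
  move=> /imfsetP[L /=]; rewrite in_fset_sep => /and3P[LE uL LI] ->.
  rewrite in_fset1; have [l|l] := ltP (endK L) (endK I).
    by have := end_in_gap IE LE l; lra.
  by apply/eqP; congr col; apply: end_in_inj => //; apply/eqP; rewrite eq_le LI.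
have gK : g (endK I) <= K.2 by lra.
rewrite leqNgt; apply/negP; rewrite degree_colours_in // => dg.
have [J [JE /andP[uJ Jg] Jc]] := last_end _ dg.
have : endK I <= endK J.
  apply: Imin; rewrite in_fset_sep JE Jc uJ /= andbT; lra.
by lra.
Qed.

(** Greedy cutting with [first_cut] either reaches a remainder with at most seven colours or goes on
    for [k.+1] rounds. *)
Lemma cuttable_or_fat k u v : K.1 <= u -> v <= K.2 ->
  cuttable k u v \/ fat k.+1 u v.
Proof.
elim: k u => [|k IH] u Ku vK;
  have [d|d] := leqP (degree S A (u, v)) 7; try by left; apply: cuttable_degree.
  have [I [IE ug Iv _ c]] := first_cut Ku vK d; right; exists I; split=> //.
  by have [/andP[_ gI] _] := gP (end_in_gt0 IE); rewrite Iv andbT; lra.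
have [I [IE ug Iv dI c]] := first_cut Ku vK d.
have [/andP[_ gI] _] := gP (end_in_gt0 IE).
have [|c'|f] := IH (g (endK I)) _ vK; first by lra.
  by left; right; exists I.
by right; exists I; split=> //; rewrite Iv andbT; lra.
Qed.

(** Each segment starts at the cut just before the end of its predecessor, so an entering endpoint
    past that start is at or past that end. *)
Lemma fat_segments k u v : fat k u v -> exists a : nat -> R * R,
  [/\ forall i, (i < k)%N -> u <= (a i).1,
      forall i, (i < k)%N ->
        (7 < #|` colours_in (fun x => ((a i).1 < x <= (a i).2)%R)|)%N
    & forall i j L, (i < j < k)%N -> L \in E -> (a j).1 < endK L ->
        (a i).2 <= endK L].
Proof.
elim: k u => [|k IH] u; first by exists (fun _ => (0, 0)); split=> // i j L; lia.
move=> [I [IE /andP[uI _] c /IH[a [au ac aa]]]].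
have [/andP[_ gI] _] := gP (end_in_gt0 IE).
exists (fun i => if i is i'.+1 then a i' else (u, endK I)); split.
(* The starts do not go back: otherwise the first segment would hold one entering endpoint, hence
   one colour. *)
- case=> // i; rewrite ltnS => /au; have [l|l] := leP u (g (endK I)); first by lra.
  move=> _; exfalso.
  move: c; apply/negP; rewrite -leqNgt; apply: (@leq_trans 1) => //.
  rewrite -(cardfs1 (col I)); apply: fsubset_leq_card; apply/fsubsetP => c.
  move=> /imfsetP[L /=]; rewrite in_fset_sep => /and3P[LE uL LI] ->.
  rewrite in_fset1; have [l'|l'] := ltP (endK L) (endK I).
    by have := end_in_gap IE LE l'; lra.
  by apply/eqP; congr col; apply: end_in_inj => //; apply/eqP; rewrite eq_le LI.
- by case=> // i; exact: ac.
- case=> [|i] [|j] L //=; last exact: aa.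
  rewrite ltnS => jk LE jL; rewrite leNgt; apply/negP => l.
  by have := end_in_gap IE LE l; have := au j jk; lra.
Qed.

(* In an 8 x 13 matrix with eight ones per row, the ones lie on 20 diagonals,
   so some diagonal carries four of them: a forbidden increasing chain. *)
Lemma not_fat u v : (omega S <= 3)%N -> (degree S A K <= 13)%N -> ~ fat 8 u v.
Proof.
move=> w3 d13 /fat_segments[a [_ ac aa]].
(* A pair is a matrix entry: its row, which is a segment, and an interval whose entering endpoint is
   in it. Rows are listed in order, with distinct colours within a row. *)
pose r (p q : nat * (R * R)) :=
  (p.1 < q.1)%N || (p.1 == q.1) && (col p.2 != col q.2).
have rows k : (k <= 8)%N -> exists ts : seq (nat * (R * R)),
    [/\ size ts = (8 * k)%N,
      forall p, p \in ts -> [/\ (p.1 < k)%N, p.2 \in E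
        & (a p.1).1 < endK p.2 <= (a p.1).2]
      & pairwise r ts].
  elim: k => [|k IH] k8; first by exists [::]; rewrite muln0.
  have [ts [szt tP pt]] := IH (ltnW k8).
  have kc := ac k k8.
  set cs := colours_in _ in kc.
  have [|s [sD Es]] := @imfset_choose _ _ col
      [fset L in E | (a k).1 < endK L <= (a k).2] (take 8 cs).
    by move=> c /mem_take.
  have szs : size s = 8%N by rewrite -(size_map col) Es size_takel.
  exists (ts ++ map (pair k) s); split.
  - by rewrite size_cat szt size_map szs mulnS addnC.
  - move=> p; rewrite mem_cat => /orP[/tP[p1 p2 p3]|]; first by split=> //; exact: ltnW.
    by move=> /mapP[L /sD]; rewrite in_fset_sep => /andP[LE Lk] ->.
  - rewrite pairwise_cat pt pairwise_map /=; apply/andP; split.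
      by apply/allrelP => p q /tP[pk _ _] /mapP[L _ ->]; rewrite /r pk.
    have : uniq (map col s) by rewrite Es take_uniq // fset_uniq.
    rewrite uniq_pairwise pairwise_map; apply: sub_pairwise => L L' /= n.
    by rewrite /r eqxx n orbT.
have [ts [szt tP pt]] := rows 8%N (leqnn 8).
(* The rank is below 13 and the row below 8, so the subtraction is exact and there are at most 20
   values; the 64 entries exceed [20 * 3]. *)
pose diag (p : nat * (R * R)) := (rank S A K p.2 + (7 - p.1))%N.
have [||d] := @count_pigeonhole 20%N 3%N (map diag ts); rewrite ?size_map ?szt //.
  move=> _ /mapP[p /tP[p8 pE _] ->].
  have := leq_trans (rank_lt_degree VA aK pE) d13; rewrite /diag.
  by move: (rank _ _ _ _) (p.1 : nat) p8 => x y; lia.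
rewrite count_map -size_filter; set fs := filter _ ts => szf.
suff : (size (map snd fs) <= omega S)%N by rewrite size_map; lia.
have fsP p : p \in fs -> [/\ diag p = d, (p.1 < 8)%N, p.2 \in E
    & (a p.1).1 < endK p.2 <= (a p.1).2].
  by rewrite mem_filter => /andP[/eqP ? /tP[]].
apply: (chain_size VA aK).
  by move=> _ /mapP[p /fsP[_ _ pE _] ->].
rewrite pairwise_map.
apply: (@sub_in_pairwise _ (mem fs) _ _ _ fs); last first.
- exact: subseq_pairwise (filter_subseq _ _) pt.
- exact/allP.
move=> p q /fsP[dp p8 pE /andP[_ pa]] /fsP[dq q8 qE /andP[aq _]] /=.
rewrite /diag in dp dq.
(* Two entries in one row and on one diagonal would have equal ranks, hence the same colour. *)
case/orP => [lt|/andP[/eqP E1 nc]]; last first.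
  have : rank S A K p.2 = rank S A K q.2.
    by apply: (@addIn (7 - p.1)%N); rewrite dp -dq E1.
  by move=> /(rank_eq_colour VA aK pE qE) E2; rewrite E2 eqxx in nc.
have rpq : (rank S A K p.2 < rank S A K q.2)%N.
  move: dp dq lt p8 q8; rewrite -[p.1]/(p.1 : nat) -[q.1]/(q.1 : nat).
  by move: (rank _ _ _ _) (rank _ _ _ _) (p.1 : nat) (q.1 : nat) => x y z t; lia.
rewrite rpq /=; have := aa p.1 q.1 q.2; rewrite lt q8 qE aq => /(_ isT isT isT) le.
(* Equal endpoints would make the intervals, and so the ranks, equal. *)
rewrite lt_neqAle (le_trans pa le) andbT.
by apply: contraTneq rpq => /(end_in_inj pE qE) ->; rewrite ltnn.
Qed.

End Cuts.

(** * Adding pillars within nineteen colours *)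

Section Completion.
Variables (R : realType) (S : {fset R * R}).
Hypothesis HS : interval_system S.
Hypothesis w3 : (omega S <= 3)%N.
Variable g : R -> R.
Hypothesis gP : forall e, 0 < e -> 0 < g e < e /\
  forall I, I \in S -> (I.1 < e -> I.1 < g e) /\ (I.2 < e -> I.2 < g e).
Implicit Types (A B : assignment R) (I J K L : R * R) (u v p : R).

(** The invariant bounds the colours themselves rather than their number, which is the form of bound
    that [insert_pillar] provides. *)
Definition palette_bounded A : Prop :=
  forall I c, (pa_col A).[? I] = Some c -> (0 < c <= 19)%N.

Definition apart L J : Prop := L.2 <= J.1 \/ J.2 <= L.1.

Lemma gap_pillar e : 0 < e <= 1 -> pillar S (g e).
Proof.
move=> /andP[e0 e1]; have [ge gS] := gP e0; split; first by lra.
move=> I /gS[a b]; split; apply/eqP => E.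
  by move: a; rewrite -E => /(_ _); lra.
by move: b; rewrite -E => /(_ _); lra.
Qed.

Lemma arch_le A K : pillar_assignment S A -> arch A K ->
  forall r, r \in 0 |` (1 |` pa_pillars A) -> r <= K.1 \/ K.2 <= r.
Proof.
move=> VA aK r; have [K0 K1] := arch_bounds VA aK.
have [K12 _ _ nK] := aK.
rewrite !in_fset1U => /or3P[/eqP->|/eqP->|/nK]; [by left|by right|].
by rewrite in_itv /=; have [l|l] := leP r K.1; [left|right; lra].
Qed.

(** No end of an arch lies inside another arch. *)
Lemma arch_inside_or_apart A J K : pillar_assignment S A -> arch A J -> arch A K ->
  (J.1 <= K.1 /\ K.2 <= J.2) \/ apart K J.
Proof.
move=> VA aJ aK; have [J12 J1 J2 _] := aJ; have [K12 K1 K2 _] := aK.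
rewrite /apart.
have [a|a] := arch_le VA aJ K1; last by right; right.
have [b|b] := arch_le VA aJ K2; first by right; left.
have [c|c] := arch_le VA aK J1; last by right; left.
have [d|d] := arch_le VA aK J2; first by right; right.
by left; split; lra.
Qed.

(** An arch of [B] has no end of [J] inside it, and one apart from [J] cannot end at [p]. *)
Lemma arch_insert A B J p L : pillar_assignment S A -> arch A J -> p \in oitv J ->
  pa_pillars B = p |` pa_pillars A -> arch B L ->
  (J.1 <= L.1 /\ L.2 <= J.2) \/ (arch A L /\ apart L J).
Proof.
move=> VA aJ; rewrite in_itv /= => pJ PB [L12 L1 L2 nL].
have [J0 Jb] := arch_bounds VA aJ; have [J12 J1 J2 nJ] := aJ.
have nLA q : q \in pa_pillars A -> q \notin oitv L.
  by move=> qA; apply: nL; rewrite PB in_fset1U qA orbT.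
have nLb q : q \in 0 |` (1 |` pa_pillars A) -> 0 < q < 1 -> q <= L.1 \/ L.2 <= q.
  rewrite !in_fset1U => /or3P[/eqP->|/eqP->|/nLA]; try lra.
  by rewrite in_itv /= => n _; have [l|l] := leP q L.1; [left|right; lra].
have L01 r : r \in 0 |` (1 |` pa_pillars B) -> 0 <= r <= 1.
  rewrite PB !in_fset1U => /or4P[/eqP->|/eqP->|/eqP->|rA]; try lra.
  by have [VP _ _ _] := VA; have [] := VP r rA; lra.
have b1 := L01 _ L1; have b2 := L01 _ L2.
have [ins|nins] := boolP ((J.1 <= L.1) && (L.2 <= J.2)).
  by left; apply/andP.
right; have ap : apart L J.
  rewrite /apart; have [l|l] := ltP L.1 J.1.
    by have [||] := nLb J.1 J1; [lra|lra|left].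
  have l2 : J.2 < L.2 by move: nins; rewrite l /=; lra.
  by have [||] := nLb J.2 J2; [lra|right|lra].
split=> //; split=> //.
- move: L1; rewrite PB !in_fset1U => /or4P[->//|->|/eqP E|->]; rewrite ?orbT //.
  by case: ap; lra.
- move: L2; rewrite PB !in_fset1U => /or4P[->//|->|/eqP E|->]; rewrite ?orbT //.
  by case: ap; lra.
Qed.

Lemma insert_pillar_bounded A J p w : pillar_assignment S A -> palette_bounded A ->
  arch A J -> p \in oitv J -> pillar S p ->
  (omega (uncovered S A p) <= w)%N -> (degree S A J + w <= 19)%N ->
  exists B, [/\ pillar_assignment S B, palette_bounded B, extends A B,
    pa_pillars B = p |` pa_pillars A
  & (forall L, degree S B L <= degree S A L + w)%N /\
    forall L, apart L J -> degree S B L = degree S A L].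
Proof.
move=> VA bA aJ pJ pp wp d19.
have [B [VB eB PB dB [cX cB]]] := insert_pillar HS VA aJ pJ pp.
exists B; split=> //.
  move=> I c Ic; have := domf_fnd Ic; rewrite dB in_fsetU => /orP[IA|IX].
    have [c' Ic'] := fnd_domf IA; have [_ _ _ /(_ _ _ Ic')] := eB.
    by rewrite Ic => -[->]; exact: bA Ic'.
  have /andP[-> h] := cB _ _ IX Ic; apply: leq_trans h (leq_trans _ d19).
  by rewrite leq_add2l.
split=> L; first by rewrite (leq_trans (degree_le_insert S L eB dB)) // leq_add2l (leq_trans cX).
apply: (degree_eq_insert HS eB dB) => I; exact: uncovered_in_arch.
Qed.

(* A clique among the new intervals through a point just before an endpoint of
   a coloured interval that leaves the arch extends by that interval. *)
Lemma omega_uncovered_le2 A A' K I J :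
  pillar_assignment S A -> arch A K -> extends A A' ->
  I \in entering A K -> arch A' J -> K.1 <= J.1 -> J.2 <= K.2 ->
  J.1 < g (end_in K I) -> end_in K I < J.2 ->
  (omega (uncovered S A' (g (end_in K I))) <= 2)%N.
Proof.
move=> VA aK [PA _ _ _] IE aJ KJ JK Jg eJ; set p := g _.
have e0 := end_in_gt0 VA aK IE; have [/andP[g0 ge] gS] := gP e0.
have pJ : p \in oitv J by rewrite in_itv /= /p; lra.
have IS := entering_S VA IE.
have [[Id rA rI _] cI] := enteringP VA aK IE.
have [s [sX ps <-]] := omega_witness (uncovered S A' p).
rewrite -ltnS; apply: leq_trans w3; rewrite -[(size s).+1]/(size (I :: s)).
apply: omega_ge.
  by move=> L; rewrite inE => /predU1P[->//|/sX /uncoveredP[]].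
rewrite /= ps andbT; apply/allP => L Ls.
have LX := sX L Ls.
have [a b] := uncovered_in_arch HS aJ pJ LX.
have /uncoveredP[LS pL nL] := LX; rewrite in_itv /= in pL.
have nIL : I != L.
  apply/eqP => E; have := nL _ (fsubsetP PA _ rA).
  by rewrite in_itv /= -E rI.
have [_ _ n21 n22] := HS.2 _ _ IS LS nIL; have [n11 n12 _ _] := HS.2 _ _ IS LS nIL.
(* No endpoint lies between [p] and the entering endpoint of [I], so [L] reaches at least to the
   latter. *)
have gL : end_in K I <= L.2.
  by rewrite leNgt; apply/negP => l; have [_ /(_ l)] := gS L LS; rewrite -/p; lra.
rewrite /p in pL.
(* [L] stays within [J], whereas [I] leaves [K] to contain its pillar; this orders the far ends. *)
case: cI => -[IK [rK E]]; rewrite E in gL eJ ge pL.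
  have lt : I.1 < L.2 by rewrite lt_neqAle n12.
  rewrite overlaps_sym; apply: crosses_overlaps.
  by rewrite /crosses; apply/and3P; split=> //; lra.
have lt : I.2 < L.2 by rewrite lt_neqAle n22.
by apply: crosses_overlaps; apply/and3P; split; lra.
Qed.

(** * Inserting the cuts in tree order *)

Section Cutting.
Variables (A : assignment R) (K : R * R).
Hypothesis VA : pillar_assignment S A.
Hypothesis aK : arch A K.
Hypothesis dK : (degree S A K <= 13)%N.

(* [3 - n] is the depth reached in the binary tree of cuts; a segment has met at
   most two new colours per level. *)
Lemma insert_cuts n A' u v : (n <= 3)%N -> K.1 <= u -> v <= K.2 ->
  cuttable S A K g (2 ^ n).-1 u v ->
  extends A A' -> pillar_assignment S A' -> palette_bounded A' -> arch A' (u, v) ->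
  (forall a b, u <= a -> b <= v ->
     (degree S A' (a, b) <= degree S A (a, b) + 2 * (3 - n))%N) ->
  exists B, [/\ pillar_assignment S B, palette_bounded B, extends A' B,
    (forall L, arch B L ->
       [/\ u <= L.1, L.2 <= v & (degree S B L <= 13)%N] \/
       arch A' L /\ apart L (u, v)) /\
    (forall L, apart L (u, v) ->
       degree S B L = degree S A' L /\ (arch A' L -> arch B L))
  & (7 < degree S A (u, v))%N -> exists I, [/\ I \in entering A K,
       g (end_in K I) \in pa_pillars B & u < g (end_in K I) < v]].
Proof.
elim: n A' u v => [|n IH] A' u v n3 Ku vK cut eA VA' bA' auv dA'.
  (* No cut is left: the segment has at most 7 old colours, and at most two new ones for each of
     three levels. *)
  have d7 : (degree S A (u, v) <= 7)%N by case: cut => [|[]].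
  exists A'; split=> //; first exact: extends_refl.
    split=> // L aL; have [[a b]|ap] := arch_inside_or_apart VA' auv aL; last by right.
    left; split=> //; case: L aL a b => a b aL /= ua bv.
    apply: leq_trans (dA' a b ua bv) _; rewrite subn0 -[13%N]/(7 + 2 * 3)%N leq_add2r.
    apply: leq_trans d7; apply: fsubset_leq_card; apply/fsubsetP => c.
    move=> /in_codomf_restrict[I Iab Ic]; apply/in_codomf_restrict; exists I => //.
    move: Iab; rewrite !in_fset_sep !in_itv /= => /andP[-> /orP[] ab] /=; apply/orP;
      [left|right]; clear Ic; lra.
  by rewrite ltnNge d7.
have E2 : (2 ^ n.+1).-1 = ((2 ^ n).-1 + (2 ^ n).-1).+1.
  by rewrite expnS; have := expn_gt0 2 n; lia.
rewrite E2 in cut.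
(* Either half of the cuts suffice and this level inserts nothing, or the middle cut is inserted and
   the two sides are treated in turn. *)
have [cl|[I [IE ug ev cl cr]]] := cuttable_split VA aK gP cut.
  apply: IH cl _ _ _ _ _ => //; first exact: ltnW.
  move=> a b ua bv; apply: leq_trans (dA' a b ua bv) _; rewrite leq_add2l.
  by move: n3; clear; lia.
set p := g (end_in K I) in ug cl cr.
have e0 := end_in_gt0 VA aK IE; have [/andP[g0 ge] gS] := gP e0.
have pv : p < v by apply: lt_trans ev.
have puv : p \in oitv (u, v) by rewrite in_itv /= ug pv.
have duv : (degree S A (u, v) <= 13)%N.
  apply: leq_trans dK; apply: fsubset_leq_card; apply/fsubsetP => c.
  move=> /in_codomf_restrict[L Luv Lc]; apply/in_codomf_restrict; exists L => //.
  move: Luv; rewrite !in_fset_sep !in_itv /= => /andP[-> /orP[] ab] /=; apply/orP;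
    [left|right]; clear Lc; lra.
have pp : pillar S p.
  apply: gap_pillar; rewrite e0; have [_ K1] := arch_bounds VA aK.
  by have := entering_end VA aK IE; lra.
have [||B1 [VB1 bB1 eB1 PB1 [dB1 dB1']]] :=
  @insert_pillar_bounded A' (u, v) p 2%N VA' bA' auv puv pp.
- by apply: (omega_uncovered_le2 VA aK eA IE auv).
(* At most 13 old colours, [2 * 2] from the levels above and 2 at this one make 19. *)
- have := dA' u v (lexx _) (lexx _).
  by move: (degree S A' _) (degree S A _) duv n3 => x y; clear; lia.
have [uv u1 v2 nuv] := auv.
have inB q : q \in 0 |` (1 |` pa_pillars A') -> q \in 0 |` (1 |` pa_pillars B1).
  rewrite PB1 !in_fset1U => /or3P[->|->|->]; by rewrite ?orbT.
have pB : p \in 0 |` (1 |` pa_pillars B1) by rewrite PB1 !in_fset1U eqxx !orbT.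
have nB q : q \in pa_pillars B1 -> q = p \/ ~~ (u < q < v).
  rewrite PB1 in_fset1U => /predU1P[->|/nuv]; first by left.
  by rewrite in_itv; right.
have al : arch B1 (u, p).
  split=> //=; first exact: inB.
  by move=> q /nB[->|]; rewrite in_itv /= ?ltxx ?andbF //; lra.
have ar : arch B1 (p, v).
  split=> //=; first exact: inB.
  by move=> q /nB[->|]; rewrite in_itv /= ?ltxx //; lra.
have eAB1 := extends_trans eA eB1.
have Kp : K.1 <= p by lra.
have pK : p <= K.2 by lra.
have dlt a b : u <= a -> b <= v ->
    (degree S B1 (a, b) <= degree S A (a, b) + 2 * (3 - n))%N.
  move=> ua bv; apply: leq_trans (dB1 _) _.
  have := dA' a b ua bv.
  by move: (degree S A' _) (degree S A _) n3 => x y; clear; lia.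
have [B2 [VB2 bB2 eB2 [aB2 dB2] _]] : exists B, [/\ pillar_assignment S B,
    palette_bounded B, extends B1 B,
    (forall L, arch B L ->
       [/\ u <= L.1, L.2 <= p & (degree S B L <= 13)%N] \/
       arch B1 L /\ apart L (u, p)) /\
    (forall L, apart L (u, p) ->
       degree S B L = degree S B1 L /\ (arch B1 L -> arch B L))
  & (7 < degree S A (u, p))%N -> exists I, [/\ I \in entering A K,
       g (end_in K I) \in pa_pillars B & u < g (end_in K I) < p]].
  apply: IH => //; first exact: ltnW.
  by move=> a b ua bp; apply: dlt => //; lra.
have apr L : p <= L.1 -> apart L (u, p) by right.
(* The right side is apart from the left one, so it is still an arch and its degrees are those in
   [B1]. *)
have [B3 [VB3 bB3 eB3 [aB3 dB3] _]] : exists B, [/\ pillar_assignment S B,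
    palette_bounded B, extends B2 B,
    (forall L, arch B L ->
       [/\ p <= L.1, L.2 <= v & (degree S B L <= 13)%N] \/
       arch B2 L /\ apart L (p, v)) /\
    (forall L, apart L (p, v) ->
       degree S B L = degree S B2 L /\ (arch B2 L -> arch B L))
  & (7 < degree S A (p, v))%N -> exists I, [/\ I \in entering A K,
       g (end_in K I) \in pa_pillars B & p < g (end_in K I) < v]].
  apply: IH => //; first exact: ltnW.
  - exact: extends_trans eB2.
  - by have [_] := dB2 (p, v) (apr (p, v) (lexx p)); exact.
  - move=> a b pa bv; have [-> _] := dB2 (a, b) (apr (a, b) pa).
    by apply: dlt => //; lra.
have pB3 : p \in pa_pillars B3.
  have [s2 _ _ _] := eB2; have [s3 _ _ _] := eB3.
  by apply: (fsubsetP s3); apply: (fsubsetP s2); rewrite PB1 in_fset1U eqxx.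
exists B3; split=> //.
- exact: extends_trans eB1 (extends_trans eB2 eB3).
- split.
    move=> L /aB3[[pL Lv d]|[aL2 ap]]; first by left; split=> //; lra.
    have [d3 _] := dB3 L ap.
    have [[uL Lp d]|[aL1 ap']] := aB2 L aL2; first by left; split=> //; [lra | rewrite d3].
    have [L12 _ _ _] := aL1.
    have [[/= uL Lv]|//] := arch_insert VA' auv puv PB1 aL1; last by right.
    by exfalso; case: ap => /= ?; case: ap' => /= ?; lra.
  move=> L ap; have apl : apart L (u, p) by case: ap => /= ?; [left|right] => /=; lra.
  have apr' : apart L (p, v) by case: ap => /= ?; [left|right] => /=; lra.
  have [-> a3] := dB3 L apr'; have [-> a2] := dB2 L apl; rewrite dB1' //; split=> //.
  move=> aL; apply: a3; apply: a2; have [L12 L1 L2 nL] := aL.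
  split; [by [] | exact: inB | exact: inB |].
  move=> q; rewrite PB1 in_fset1U => /predU1P[->|/nL//].
  by rewrite in_itv /=; case: ap => /= ?; lra.
- by move=> _; exists I; split=> //; rewrite -/p ug pv.
Qed.

End Cutting.

(** * Iteration up to a complete assignment *)

Lemma arch_exists A I : pillar_assignment S A -> I \in S ->
  (forall q, q \in pa_pillars A -> q \notin oitv I) ->
  exists K, [/\ arch A K, K.1 <= I.1 & I.2 <= K.2].
Proof.
move=> [VP _ _ _] IS nI; have [I0 I12 I1] := HS.1 _ IS.
(* The arch is bounded by the nearest of [0], [1] and the pillars on either side of [I]. *)
have [|k1] := @seq_max R _ id [seq q <- 0 |` (1 |` pa_pillars A) | q <= I.1] 0.
  by rewrite mem_filter I0 in_fset1U eqxx.
rewrite mem_filter => /andP[kI k1P] k1m.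
have [|k2] := @seq_min R _ id [seq q <- 0 |` (1 |` pa_pillars A) | I.2 <= q] 1.
  by rewrite mem_filter I1 !in_fset1U eqxx orbT.
rewrite mem_filter => /andP[Ik k2P] k2m.
exists (k1, k2); split=> //; split=> //=; first by lra.
move=> q qP; apply/negP; rewrite in_itv /= => qk.
have qb : q \in 0 |` (1 |` pa_pillars A) by rewrite !in_fset1U qP !orbT.
have := nI q qP; rewrite in_itv /=.
have [l|l] := leP q I.1.
  by have := k1m q; rewrite mem_filter l qb => /(_ isT) /=; lra.
have [l'|l'] := leP I.2 q; last by [].
by have := k2m q; rewrite mem_filter l' qb => /(_ isT) /=; lra.
Qed.

(** Each round adds [g e] for a new [e] in this finite list, which bounds the number of rounds. *)
Definition endpoints : seq R := map fst S ++ map snd S.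

Lemma extend_step A : pillar_assignment S A -> palette_bounded A ->
  (forall K, arch A K -> (degree S A K <= 13)%N) -> ~ complete S A ->
  exists B, [/\ pillar_assignment S B, palette_bounded B,
    forall K, arch B K -> (degree S B K <= 13)%N, extends A B
  & exists e, [/\ e \in endpoints, g e \notin pa_pillars A & g e \in pa_pillars B]].
Proof.
move=> VA bA dA nc.
have [I IS nI] : exists2 I, I \in S & forall q, q \in pa_pillars A -> q \notin oitv I.
  apply: contrapT => H; apply: nc => P I IS; apply: contrapT => H'; apply: H.
  by exists I => // q qP; apply/negP => qI; apply: H'; exists q.
have [K [aK KI IK]] := arch_exists VA IS nI.
have [I0 I12 I1] := HS.1 _ IS.
have nK q : q \in oitv K -> q \notin pa_pillars A.
  by have [_ _ _ nK] := aK; apply: contraTN => /nK.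
have dK := dA K aK.
(* The threshold is [13 - 3], as a pillar chosen inside [I] alone may add three colours. *)
have [d10|d11] := leqP (degree S A K) 10.
  have I20 : 0 < I.2 by lra.
  have [ge gS] := gP I20; have [/(_ I12) gI _] := gS I IS.
  have pK : g I.2 \in oitv K by rewrite in_itv /=; lra.
  have pp : pillar S (g I.2) by apply: gap_pillar; rewrite I20.
  have wp : (omega (uncovered S A (g I.2)) <= 3)%N.
    apply: leq_trans w3; apply: omega_sub; apply/fsubsetP => J.
    by move=> /uncoveredP[].
  have [|B [VB bB eB PB [dB dB']]] := insert_pillar_bounded VA bA aK pK pp wp.
    by apply: leq_trans (leq_add d10 (leqnn 3)) _.
  exists B; split=> //.
    move=> L /(arch_insert VA aK pK PB)[[a b]|[aL ap]]; last by rewrite dB' // dA.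
    apply: leq_trans (dB L) _; rewrite -[13%N]/(10 + 3)%N leq_add2r.
    apply: leq_trans d10; apply: fsubset_leq_card; apply/fsubsetP => c.
    move=> /in_codomf_restrict[J JL Jc]; apply/in_codomf_restrict; exists J => //.
    move: JL; rewrite !in_fset_sep !in_itv /= => /andP[-> /orP[] ab] /=; apply/orP;
      [left|right]; clear Jc; lra.
  exists I.2; split; last by rewrite PB in_fset1U eqxx.
    by rewrite mem_cat map_f ?orbT.
  exact: nK.
(* Seven cuts are the nodes of a full binary tree with three levels. *)
have [cut|f] := cuttable_or_fat HS VA aK gP 7%N (lexx K.1) (lexx K.2); last first.
  by case: (not_fat HS VA aK gP w3 dK f).
have EK : (K.1, K.2) = K by case: (K).
have [||B [VB bB eB [aB dB] ex]] := insert_cuts VA aK dK (n := 3) (A' := A)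
    (leqnn 3) (lexx K.1) (lexx K.2) cut (extends_refl A) VA bA.
- by rewrite EK.
- by move=> a b _ _; exact: leq_addr.
exists B; split=> //.
  by move=> L /aB[[_ _]//|[aL ap]]; have [-> _] := dB L ap; exact: dA.
(* Degree at least 11 exceeds 7, so some cut has been made. *)
have [|J [JE JB Jg]] := ex; first by rewrite EK (leq_trans _ d11).
exists (end_in K J); split=> //.
  have JS := entering_S VA JE.
  by case: (end_in_cases K J) => ->; rewrite mem_cat map_f ?orbT.
by apply: nK; rewrite in_itv.
Qed.

(** Induction on the number of endpoints [e] for which [g e] is not yet a pillar. *)
Lemma extend_complete A : pillar_assignment S A -> palette_bounded A ->
  (forall K, arch A K -> (degree S A K <= 13)%N) ->
  exists B, [/\ pillar_assignment S B, complete S B, extends A B & palette_bounded B].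
Proof.
pose mu A := count (fun e => g e \notin pa_pillars A) endpoints.
have [n] := ubnP (mu A); elim: n A => // n IH A mun VA bA dA.
have [c|nc] := pselect (complete S A); first by exists A; split=> //; exact: extends_refl.
have [B [VB bB dB eB [e [eE eA eB']]]] := extend_step VA bA dA nc.
have [|C [VC cC eC bC]] := IH B _ VB bB dB; last first.
  by exists C; split=> //; exact: extends_trans eB eC.
rewrite -ltnS; apply: leq_trans mun; rewrite ltnS /mu.
have [sAB _ _ _] := eB.
rewrite -!size_filter; set sB := filter _ _; set sA := filter _ _.
have Es : sB = [seq x <- sA | g x \notin pa_pillars B].
  rewrite -filter_predI; apply: eq_filter => x /=.
  by apply/idP/andP => [H|[]//]; split=> //; apply: contra H; exact: fsubsetP.
rewrite Es size_filter -(count_predC (fun x => g x \notin pa_pillars B) sA).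
rewrite -[X in (X < _)%N]addn0 ltn_add2l -has_count; apply/hasP; exists e.
  by rewrite mem_filter eA.
by rewrite /= eB'.
Qed.

End Completion.

(** * From the number of colours to their size, and back *)

Lemma structured_colouring_uses (R : realType) (X : {fset R * R}) (C : {fset nat}) phi :
  structured_colouring X C phi -> C `<=` codomf phi.
Proof.
move=> [_ [_ zC] [dX cC] pr _].
(* The members of a maximum clique have distinct colours, as many as [C] contains. *)
have [s [sX ps szs]] := omega_witness X.
have sphi I : I \in s -> exists c, phi.[? I] = Some c.
  by move=> /sX; rewrite -dX; exact: fnd_domf.
have us : uniq [seq odflt 0%N phi.[? J] | J <- s].
  rewrite uniq_pairwise pairwise_map; apply: (@sub_in_pairwise _ (mem s) _ _ _ _ _ ps).
    move=> I J /sphi[c Ic] /sphi[d Jd] /= /asboolP oIJ; rewrite Ic Jd /=.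
    by apply/eqP => E; apply: (pr I J c oIJ Ic); rewrite Jd E.
  exact/allP.
have sub : {subset [seq odflt 0%N phi.[? J] | J <- s] <= codomf phi}.
  by move=> _ /mapP[I /sphi[c Ic] ->]; rewrite Ic; apply/codomfP; exists I.
have le : (#|` C| <= #|` codomf phi|)%N.
  by rewrite zC -szs -(size_map (fun I => odflt 0%N phi.[? I])); exact: uniq_leq_size.
suff /eqP -> : codomf phi == C by [].
by rewrite eqEfcard cC le.
Qed.

(* Each pillar uses all of its colours, which are the smallest available ones,
   so the used colours form an initial segment. *)
Lemma chi_palette_bounded (R : realType) (S : {fset R * R}) (A : assignment R) :
  pillar_assignment S A -> (chi A <= 19)%N -> palette_bounded A.
Proof.
move=> VA chA I c Ic; have [_ _ _ Vc] := VA.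
have init d : (0 < d <= c)%N -> d \in codomf (pa_col A).
  move=> /andP[d0]; rewrite leq_eqVlt => /predU1P[->|dc].
    by apply/codomfP; exists I.
  have [p pP Ip] := colouredP _ VA (domf_fnd Ic).
  have [F [C [_ [_ _ C2] st]]] := Vc p pP.
  have cC : c \in C.
    have [_ _ [_ /fsubsetP H] _ _] := st; apply: H.
    by apply/in_codomf_restrict; exists I.
  (* A forbidden [d] is already in use across the foundation; otherwise [d] belongs to [C], all of
     which is used. *)
  have [|dn] := boolP (d \in codomf (pa_before S A p).[& crossing S F]).
    move=> /in_codomf_restrict[J _]; rewrite fnd_restrict; case: ifP => // _ Jd.
    by apply/codomfP; exists J.
  have := C2 c d cC; rewrite d0 dc => /(_ isT dn).
  move=> /(fsubsetP (structured_colouring_uses st)) /in_codomf_restrict[J _ Jd].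
  by apply/codomfP; exists J.
have c0 : (0 < c)%N.
  have [p pP Ip] := colouredP _ VA (domf_fnd Ic).
  have [F [C [_ [_ C1 _] st]]] := Vc p pP.
  have [_ _ [_ /fsubsetP H] _ _] := st.
  have /C1[] // : c \in C by apply: H; apply/in_codomf_restrict; exists I.
rewrite c0 /=; apply: leq_trans chA; rewrite -(size_iota 1 c).
apply: uniq_leq_size; first exact: iota_uniq.
by move=> d; rewrite mem_iota add1n ltnS; exact: init.
Qed.

Lemma palette_bounded_chi (R : realType) (A : assignment R) :
  palette_bounded A -> (chi A <= 19)%N.
Proof.
move=> bA; rewrite -(size_iota 1 19); apply: uniq_leq_size; first exact: fset_uniq.
by move=> c /codomfP[I /bA]; rewrite mem_iota.
Qed.

Theorem theorem12 (R : realType) (T : finType) (e : rel T)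
    (S : {fset R * R}) (A : assignment R) :
  simple_graph e ->
  circle_graph R e ->
  (clique_number e <= 3)%N ->
  interval_system S ->
  has_overlap_graph S e ->
  pillar_assignment S A ->
  (chi A <= 19)%N ->
  (forall K : R * R, arch A K -> (degree S A K <= 13)%N) ->
  exists B : assignment R,
    [/\ pillar_assignment S B, complete S B, extends A B & (chi B <= 19)%N].
Proof.
move=> _ _ e3 HS /omega_clique_number we VA chA dA.
have w3 := leq_trans we e3.
have [g gP] := gap_pillars S.
have [B [VB cB eB bB]] :=
  extend_complete HS w3 gP VA (chi_palette_bounded VA chA) dA.
by exists B; split=> //; exact: palette_bounded_chi.
Qed.
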